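(* Let $\alpha:\mathbb{R}\to[0,\infty)$ be a symmetric convex function of class $C^1$ such that $\alpha(t)=\frac12t^2$ for $t\in[0,t_0]$ for some $t_0>0$, and $\alpha'$ is concave on $[0,\infty)$. Let $c:\mathbb{R}^d\to[0,\infty)$ be the cost function $$c(x)=\sum_{i=1}^d\alpha(x_i),\qquad x=(x_1,\dots,x_d)\in\mathbb{R}^d .$$ Let $\{\mu_\theta\}_{\theta\in\Theta}$ be a family of Borel probability measures on $\mathbb{R}^d$ which satisfy the $\mathbf{T}_c$ inequality with uniformly bounded constants: $$C_\Theta:=\sup_{\theta\in\Theta}C_{\mathbf{T}_c}(\mu_\theta)<\infty .$$ Suppose moreover that $$M_\Theta:=\sup_{\theta,\theta'\in\Theta}\chi^2(\mu_\theta\Vert\mu_{\theta'})<\infty .$$ Then the mixture $\mu_{\mathrm{mix}}$ of the family with respect to a mixing probability measure $m$ on $\Theta$ satisfies the $\mathbf{T}_c$ inequality and $$C_{\mathbf{T}_c}(\mu_{\mathrm{mix}})\le C_\Theta\cdot\bigl(16+2(2+M_\Theta)\log(1+M_\Theta)\bigr).$$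
   Context: Mixture: $(\Theta,\mathfrak{M},m)$ is a probability space, for every Borel set $A\subset\mathbb{R}^d$ the map $\theta\mapsto\mu_\theta(A)$ is measurable, and $\mu_{\mathrm{mix}}(A):=\int_\Theta \mu_\theta(A)\,dm(\theta)$ for Borel $A\subset\mathbb{R}^d$. For probability measures $\mu_1,\mu_2$ on $\mathbb{R}^d$: $\chi^2(\mu_1\Vert\mu_2):=\int\bigl(\frac{d\mu_1}{d\mu_2}-1\bigr)^2d\mu_2$ and $H(\mu_1|\mu_2):=\int\log\bigl(\frac{d\mu_1}{d\mu_2}\bigr)d\mu_1$ if $\mu_1\ll\mu_2$; both are $+\infty$ otherwise. $\mathcal{T}_c(\mu,\nu):=\inf_\pi\int_{\mathbb{R}^d\times\mathbb{R}^d}c(x-y)\,d\pi(x,y)$, the infimum over all couplings $\pi$ of $\mu$ and $\nu$. A probability measure $\mu$ on $\mathbb{R}^d$ satisfies $\mathbf{T}_c$ with constant $C\in(0,\infty)$ if $\mathcal{T}_c(\mu,\nu)\le C\,H(\nu|\mu)$ for all probability measures $\nu$ on $\mathbb{R}^d$. $C_{\mathbf{T}_c}(\mu)$ is the smallest such constant (infimum; $+\infty$ if there is none). *)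

(* Defs.v *)
From HB Require Import structures.
From mathcomp Require Import all_boot all_order all_algebra.
From mathcomp Require Import all_classical all_reals all_analysis measurable_realfun.

Set Implicit Arguments.
Unset Strict Implicit.
Unset Printing Implicit Defensive.

Import Order.TTheory GRing.Theory Num.Theory.
Import numFieldNormedType.Exports.

Local Open Scope classical_set_scope.
Local Open Scope ring_scope.

Definition Rd (R : realType) (d : nat) : measurableType _ :=
  g_sigma_algebraType (@open 'rV[R]_d).

Section divergences.
Context (disp : measure_display) (T : measurableType disp) (R : realType).
Implicit Types mu nu : probability T R.
Local Open Scope ereal_scope.
Local Open Scope charge_scope.

(* Library Radon-Nikodym derivatives are taken of charges, hence the cast *)
Definition density mu nu : T -> \bar R :=
  'd (charge_of_finite_measure mu) '/d nu.

Definition chi2 mu nu : \bar R :=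
  if `[< mu `<< nu >] then \int[nu]_x (density mu nu x - 1) ^+ 2 else +oo.

(* lne is -oo at 0 and at negative numbers; the density of mu is positive
   mu-almost everywhere and the negative part of the integrand is always
   integrable *)
Definition relative_entropy mu nu : \bar R :=
  if `[< mu `<< nu >] then \int[mu]_x lne (density mu nu x) else +oo.

End divergences.

Section transport.
Context (R : realType) (d : nat).
Implicit Types (c : 'rV[R]_d -> R) (mu nu : probability (Rd R d) R).
Local Open Scope ereal_scope.

Definition coupling mu nu : set (probability (Rd R d * Rd R d)%type R) :=
  [set pi | (forall A, measurable A -> pi (A `*` setT) = mu A) /\
            (forall B, measurable B -> pi (setT `*` B) = nu B)].

Definition transport_cost c mu nu : \bar R :=
  ereal_inf [set \int[pi]_z (c ((z.1 : 'rV[R]_d) - z.2)%R)%:E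
            | pi in coupling mu nu].

Definition satisfies_T_with c mu (C : R) : Prop :=
  (0 < C)%R /\
  forall nu, transport_cost c mu nu <= C%:E * relative_entropy nu mu.

Definition satisfies_T c mu : Prop := exists C : R, satisfies_T_with c mu C.

Definition T_constant c mu : \bar R :=
  ereal_inf [set C%:E | C in [set C : R | satisfies_T_with c mu C]].

End transport.

Definition sum_cost (R : realType) (d : nat) (alpha : R -> R)
    (x : 'rV[R]_d) : R := \sum_(i < d) alpha (x ord0 i).

Section mixture.
Context (dT : measure_display) (Theta : measurableType dT)
  (disp : measure_display) (T : measurableType disp) (R : realType)
  (m : probability Theta R) (mu : Theta -> probability T R)
  (mmu : forall A : set T, measurable A ->
    measurable_fun [set: Theta] (fun theta => mu theta A)).
Local Open Scope ereal_scope.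

(* The measurability proof is an argument because the measure structure below
   depends on it *)
Definition mixture of (forall A : set T, measurable A ->
    measurable_fun [set: Theta] (fun theta => mu theta A)) :=
  fun A : set T => \int[m]_theta mu theta A.

Local Notation mix := (mixture mmu).

Let mix0 : mix set0 = 0.
Proof. by rewrite /mixture integral0_eq. Qed.

Let mix_ge0 A : 0 <= mix A.
Proof. by rewrite /mixture integral_ge0. Qed.

Let mix_sigma_additive : semi_sigma_additive mix.
Proof.
move=> F mF tF _; rewrite [X in _ --> X](_ : _ =
    \int[m]_t (\sum_(0 <= k <oo) mu t (F k))); last first.
  apply: eq_integral => t _.
  by apply/esym/cvg_lim => //; exact: measure_sigma_additive.
rewrite [X in X @ _](_ : _ =
    (fun n => \int[m]_t (\sum_(0 <= i < n) mu t (F i)))); last first.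
  by apply/funext => n; rewrite -ge0_integral_sum// => ?; exact: mmu.
apply: cvg_monotone_convergence => //.
- by move=> n; apply: emeasurable_sum => k; exact: mmu.
- by move=> n x _; rewrite sume_ge0.
- by move=> x _ k n kn; exact: ereal_nondecreasing_series.
Qed.

HB.instance Definition _ := isMeasure.Build _ _ _ mix
  mix0 mix_ge0 mix_sigma_additive.

Let mix_setT : mix [set: T] = 1.
Proof.
transitivity (\int[m]_t (cst 1 t)).
  by apply: eq_integral => t _; exact: (@probability_setT _ _ _ (mu t)).
by rewrite integral_cst// mul1e; exact: probability_setT.
Qed.

HB.instance Definition _ := Measure_isProbability.Build _ _ _ mix mix_setT.

End mixture.

(* Main.v *)
Require Import Defs.
From HB Require Import structures.
From mathcomp Require Import all_boot all_order all_algebra.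
From mathcomp Require Import all_classical all_reals all_analysis measurable_realfun.
From mathcomp Require Import ring lra.

Set Implicit Arguments.
Unset Strict Implicit.
Unset Printing Implicit Defensive.

Import Order.TTheory GRing.Theory Num.Theory.
Import numFieldNormedType.Exports.

Local Open Scope classical_set_scope.
Local Open Scope ring_scope.

(** The inequality is proved with explicit transport plans.  Let [mu] be the
    mixture, let [nu = f mu], and put [Z t = \int f dmu_t] and
    [nu_t = f mu_t / Z t].  The mixture is carried to [nu] in two steps, through
    the measure [\int (Z t) mu_t dm(t)].

    - First step: every component with [Z t < 1] has to give away the fraction
      [u t = max 0 (1 - Z t)] of its mass, which the components with [Z > 1]
      receive.  Replace [mu_t] by [(1 - u t) mu_t + (u t) sigma], where [sigma]
      is the average of the components with [Z > 1] weighted by the positive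
      part of [Z - 1].  Since the chi-square divergence is convex in its first
      argument and dominates the entropy, the entropy of this measure relative
      to [mu_t] is at most [M (u t)^2], so the step costs at most
      [C M \int u^2 dm].  It matters that the mass is not moved from one component
      to another, which would cost a multiple of [\int u dm]: each [mu_t] is
      transported as a whole to a small perturbation of itself.
    - Second step: couple [mu_t] with [nu_t] for each [t] and average with the
      weights [Z t].  By hypothesis this costs at most
      [C * \int (Z t) H(nu_t | mu_t) dm].

    The chain rule gives [H(nu | mu)] as the sum of [\int (Z t) H(nu_t | mu_t) dm]
    and [\int Z ln Z dm], and the latter is at least [(\int u^2 dm) / 2].  A cost
    as in the theorem satisfies [c (x + y) <= 2 (c x + c y)], so composing the
    two steps bounds the transport cost by [2 max 1 (2 M) C H(nu | mu)], and
    [2 max 1 (2 M)] is smaller than the constant of the theorem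
    ([mixture_constant_ge]), with room for a factor [36 / 25].

    Averaging couplings over [Theta] would require choosing them measurably, and
    composing couplings would require disintegrating them.  Both problems vanish
    for measures on a finite set, and so the argument is carried out for the
    masses of the cells of a grid: [finite_mixture_transport] for finitely many
    components, then [infinite_mixture_transport], which replaces an infinite
    family of vectors of masses by a finite one.  The passage to the grid relies
    on rounding being almost a contraction ([cost_round_contract]), so that the
    transport inequalities of the [mu_t] descend ([transport_inequality_on_grid]),
    and on the fact that entropy and chi-square decrease ([cell_entropy_le],
    [cell_chi2_le]).  Conversely a plan between masses of cells is the discrete
    image of a coupling ([plan_lift]), whose cost exceeds that of the plan by
    the cost of rounding under [mu] and [nu].  This excess tends to zero because
    [c] is integrable for both measures, which itself follows from the
    inequality on the grids and Fatou's lemma.  Each of the two passages loses a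
    factor [6 / 5], hence the factor [36 / 25]. *)

(** * Inequalities for the logarithm *)

Section scalar_inequalities.
Context (R : realType).
Implicit Types x y z : R.

Lemma ln_le_subr1 x : 0 < x -> ln x <= x - 1.
Proof.
move=> x0; have := @le_ln1Dx R (x - 1).
by rewrite addrCA subrr addr0; apply; rewrite ltrBrDr addNr.
Qed.

(** The two sides agree at 1, and their difference has derivative
    [y - 1 - ln y >= 0]. *)
Lemma xlnx_ge_sqr x : 0 < x -> x <= 1 -> (x ^+ 2 - 1) / 2 <= x * ln x.
Proof.
move=> x0 x1; pose f : R -> R := 2^-1 \*: (id ^+ 2 : R -> R) - id * (@ln R).
have df y : 0 < y -> is_derive y 1 f (y - (1 + ln y)).
  move=> y0; rewrite /f.
  have ? : is_derive y 1 (@ln R) y^-1 by exact: is_derive1_ln.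
  have yn0 : y != 0 by rewrite gt_eqF.
  apply: is_derive_eq.
  by rewrite /= expr1 /GRing.scale/=; field.
have fE y : f y = 2^-1 * y ^+ 2 - y * ln y by [].
suff : f x <= f 1 by rewrite !fE ln1; lra.
apply: (@ger0_derive1_ndecr _ f x 1 _ _ _ x 1 (lexx x) x1 (lexx 1)).
- move=> y; rewrite in_itv/= => /andP[xy _]; have y0 := lt_trans x0 xy.
  by have [] := df y y0.
- move=> y; rewrite in_itv/= => /andP[xy _]; have y0 := lt_trans x0 xy.
  have d := df y y0; rewrite derive1E derive_val.
  by have := ln_le_subr1 y0; lra.
- apply: derivable_within_continuous => y; rewrite in_itv/= => /andP[xy _].
  by have [] := df y (lt_le_trans x0 xy).
Qed.

(** The sharp factor [1 / 2] matters: the factor [1 / 4] given by the elementary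
    bound [z ln z - z + 1 >= (1 - sqrt z)^2] is too small for the final
    constant. *)
Lemma xlnx_ge_quad z : 0 <= z ->
  z - 1 + 2^-1 * (Num.max 0 (1 - z)) ^+ 2 <= z * ln z.
Proof.
rewrite le_eqVlt => /predU1P[<-|z0].
  by rewrite mul0r subr0 maxEle ler01 expr1n mulr1; lra.
have [z1|/ltW z1] := leP z 1.
  rewrite maxEle subr_ge0 z1.
  by have := xlnx_ge_sqr z0 z1; lra.
have -> : Num.max 0 (1 - z) = 0 by apply/max_idPl; rewrite subr_le0.
rewrite expr0n/= mulr0 addr0.
have := @ln_le_subr1 z^-1; rewrite invr_gt0 => /(_ z0).
rewrite lnV ?posrE// => h.
have : z * (1 - z^-1) <= z * ln z by rewrite ler_pM2l//; lra.
by rewrite mulrBr mulr1 mulfV ?gt_eqF.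
Qed.

(** The right-hand side is convex; [3 y - expR 2] is its tangent at [expR 2]. *)
Lemma xlnx_ge_tangent y : 0 < y -> 3 * y - 10 <= y * ln y.
Proof.
move=> y0.
(* [expR 2 <= 10], from [1 - 1/4 <= expR (- 1/4)] raised to the eighth power *)
have e2 : expR 2 <= 10 :> R.
  have h : (3 / 4 : R) <= expR (- (1 / 4)) by have := @expR_ge1Dx R (- (1 / 4)); lra.
  have : (3 / 4 : R) ^+ 8 <= expR (- (1 / 4)) ^+ 8.
    by apply: lerXn2r => //; rewrite nnegrE ?expR_ge0//; lra.
  rewrite -expRM_natl; have -> : 8%:R * - (1 / 4) = - 2 :> R by lra.
  have E0 := expR_gt0 (2 : R); rewrite expRN -(ler_pM2l E0) mulfV ?gt_eqF//.
  by rewrite !exprS expr0; lra.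
have := @ln_le_subr1 (expR 2 / y); rewrite divr_gt0 ?expR_gt0// => /(_ isT).
rewrite ln_div ?posrE ?expR_gt0// expRK => h.
have : y * (2 - ln y) <= y * (expR 2 / y - 1) by rewrite ler_pM2l.
by rewrite !mulrBr mulrCA mulfV ?gt_eqF//; lra.
Qed.

(** The left-hand side is the constant that the proof yields, including the
    losses in passing to a grid and back. *)
Lemma mixture_constant_ge (M : R) : 0 <= M ->
  (6 / 5) ^+ 2 * (2 * Num.max 1 (2 * M)) <=
  16 + 2 * (2 + M) * ln (1 + M).
Proof.
move=> M0; have y0 : 0 < 1 + M by lra.
have := xlnx_ge_tangent y0; have ln0 : 0 <= ln (1 + M) by apply: ln_ge0; lra.
have Mln : 0 <= M * ln (1 + M) by rewrite mulr_ge0.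
by case: (leP 1 (2 * M)) => h; lra.
Qed.

End scalar_inequalities.

(** * Transport between vectors of masses *)

Section finite_transport.
Context (R : realType) (I : finType).
Implicit Types (p q r : I -> R) (w a : I -> I -> R).

Definition prob_vec p := (forall i, 0 <= p i) /\ \sum_i p i = 1.

Definition abs_cont q p := forall i, p i = 0 -> q i = 0.

(** Terms with [p i = 0] contribute nothing, because [x / 0 = 0] and [ln 0 = 0];
    [abs_cont q p] is therefore a separate hypothesis throughout. *)
Definition vec_entropy q p := \sum_i q i * ln (q i / p i).

Definition vec_chi2 q p := \sum_i (q i - p i) ^+ 2 / p i.

Definition plan p q w :=
  [/\ forall i j, 0 <= w i j, forall i, \sum_j w i j = p i
    & forall j, \sum_i w i j = q j].

Definition plan_cost a w := \sum_i \sum_j a i j * w i j.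

(** The optimal cost between [p] and [q] is at most [B]; an upper bound is easier
    to handle than the infimum, which would have to be attained or approximated
    at each step. *)
Definition transportable a p q B := exists2 w, plan p q w & plan_cost a w <= B.

Lemma transportable_le a p q B B' :
  B <= B' -> transportable a p q B -> transportable a p q B'.
Proof. by move=> BB' [w pw cw]; exists w => //; exact: le_trans cw BB'. Qed.

Lemma plan_eq0l p q w i j : plan p q w -> p i = 0 -> w i j = 0.
Proof.
move=> [w0 wp _] p0; have := wp i; rewrite p0 => /eqP.
by rewrite psumr_eq0 => [/allP/(_ j)|//]; rewrite mem_index_enum => /(_ isT)/eqP.
Qed.

Lemma plan_eq0r p q w i j : plan p q w -> q j = 0 -> w i j = 0.
Proof.
move=> [w0 _ wq] q0; have := wq j; rewrite q0 => /eqP.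
by rewrite psumr_eq0 => [/allP/(_ i)|//]; rewrite mem_index_enum => /(_ isT)/eqP.
Qed.

(** Composition of two plans through their common marginal [r]: given the
    intermediate point, the two endpoints are taken independent. *)
Lemma transport_glue a p q r (B1 B2 : R) :
  (forall i k l, a i l <= 2 * (a i k + a k l)) ->
  transportable a p r B1 -> transportable a r q B2 ->
  transportable a p q (2 * (B1 + B2)).
Proof.
move=> tri [w1 pw1 c1] [w2 pw2 c2].
have [w10 w1p w1r] := pw1; have [w20 w2r w2q] := pw2.
have r0 k : 0 <= r k by rewrite -w2r sumr_ge0.
(* At points [k] of zero mass all the terms vanish, which makes the division
   below harmless. *)
have cancel1 i k : w1 i k * (r k / r k) = w1 i k.
  have [rk|rk] := eqVneq (r k) 0; last by rewrite divff// mulr1.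
  by rewrite (plan_eq0r i pw1 rk) mul0r.
have cancel2 k l : w2 k l * (r k / r k) = w2 k l.
  have [rk|rk] := eqVneq (r k) 0; last by rewrite divff// mulr1.
  by rewrite (plan_eq0l l pw2 rk) mul0r.
exists (fun i l => \sum_k w1 i k * w2 k l / r k).
  split.
  - by move=> i l; apply: sumr_ge0 => k _; rewrite divr_ge0 ?mulr_ge0.
  - move=> i; rewrite exchange_big/= -w1p; apply: eq_bigr => k _.
    by rewrite -mulr_suml -mulr_sumr w2r -mulrA cancel1.
  - move=> l; rewrite exchange_big/= -w2q; apply: eq_bigr => k _.
    by rewrite -mulr_suml -mulr_suml w1r mulrAC mulrC cancel2.
apply: (@le_trans _ _ (2 * (plan_cost a w1 + plan_cost a w2))); last first.
  by rewrite ler_pM2l// lerD.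
have -> : plan_cost a w1 = \sum_i \sum_l \sum_k a i k * (w1 i k * w2 k l / r k).
  rewrite /plan_cost; apply: eq_bigr => i _; rewrite exchange_big/=.
  apply: eq_bigr => k _.
  by rewrite -mulr_sumr -mulr_suml -mulr_sumr w2r -mulrA cancel1.
have -> : plan_cost a w2 = \sum_i \sum_l \sum_k a k l * (w1 i k * w2 k l / r k).
  rewrite /plan_cost exchange_big [RHS]exchange_big/=; apply: eq_bigr => l _.
  rewrite [RHS]exchange_big/=; apply: eq_bigr => k _.
  by rewrite -mulr_sumr -!mulr_suml w1r [r k * _]mulrC -mulrA cancel2.
rewrite /plan_cost -big_split/= mulr_sumr; apply: ler_sum => i _.
rewrite -big_split/= mulr_sumr; apply: ler_sum => l _.
rewrite -big_split/= !mulr_sumr; apply: ler_sum => k _.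
by rewrite -mulrDl [leRHS]mulrA; apply: ler_wpM2r => //; rewrite divr_ge0 ?mulr_ge0.
Qed.

Lemma transport_mixture (J : finType) (m : J -> R) (p q : J -> I -> R)
    (a : I -> I -> R) (B : J -> R) :
  (forall j, 0 <= m j) -> (forall j, transportable a (p j) (q j) (B j)) ->
  transportable a (fun i => \sum_j m j * p j i) (fun i => \sum_j m j * q j i)
    (\sum_j m j * B j).
Proof.
move=> m0 pq; have /choice[w pcw] : forall j, exists w,
    plan (p j) (q j) w /\ plan_cost a w <= B j.
  by move=> j; have [w ? ?] := pq j; exists w.
exists (fun i l => \sum_j m j * w j i l).
  split.
  - move=> i l; apply: sumr_ge0 => j _; rewrite mulr_ge0//.
    by have [[+ _ _] _] := pcw j; apply.
  - move=> i; rewrite exchange_big/=; apply: eq_bigr => j _.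
    by rewrite -mulr_sumr; have [[_ -> _] _] := pcw j.
  - move=> l; rewrite exchange_big/=; apply: eq_bigr => j _.
    by rewrite -mulr_sumr; have [[_ _ ->] _] := pcw j.
rewrite [leLHS](_ : _ = \sum_j m j * plan_cost a (w j)).
  by apply: ler_sum => j _; rewrite ler_wpM2l//; have [_ +] := pcw j.
under [RHS]eq_bigr do rewrite /plan_cost mulr_sumr.
rewrite exchange_big/=; apply: eq_bigr => i _.
under [RHS]eq_bigr do rewrite mulr_sumr.
rewrite exchange_big/=; apply: eq_bigr => l _.
by rewrite mulr_sumr; apply: eq_bigr => j _; rewrite mulrCA.
Qed.

(** Termwise, [q ln (q / p) >= q - p]. *)
Lemma vec_entropy_ge0 q p :
  prob_vec q -> prob_vec p -> abs_cont q p -> 0 <= vec_entropy q p.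
Proof.
move=> [q0 q1] [p0 p1] qp.
have -> : 0 = \sum_i (q i - p i) :> R by rewrite sumrB q1 p1 subrr.
apply: ler_sum => i _.
have := q0 i; rewrite le_eqVlt => /predU1P[<-|qi0].
  by rewrite mul0r sub0r oppr_le0.
have pi0 : 0 < p i.
  by rewrite lt_neqAle p0 andbT eq_sym; apply/eqP => /qp/eqP; rewrite gt_eqF.
have := @ln_le_subr1 R (p i / q i); rewrite divr_gt0// => /(_ isT).
rewrite -[p i / q i]invf_div lnV ?posrE ?divr_gt0// invf_div => h.
have : q i * (1 - p i / q i) <= q i * ln (q i / p i) by rewrite ler_pM2l//; lra.
by rewrite mulrBr mulr1 mulrCA mulfV ?gt_eqF// mulr1.
Qed.

(** Termwise, [ln x <= x - 1] at [x = q / p]; the terms [q - p] added to the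
    right-hand side sum to zero. *)
Lemma vec_entropy_le_chi2 q p :
  prob_vec q -> prob_vec p -> abs_cont q p -> vec_entropy q p <= vec_chi2 q p.
Proof.
move=> [q0 q1] [p0 p1] qp.
have -> : vec_chi2 q p = \sum_i ((q i - p i) ^+ 2 / p i + (q i - p i)).
  by rewrite big_split/= sumrB q1 p1 subrr addr0.
apply: ler_sum => i _.
have := p0 i; rewrite le_eqVlt => /predU1P[pi|pi0].
  by rewrite -pi qp// invr0 !(mul0r,mulr0) subrr addr0.
have := q0 i; rewrite le_eqVlt => /predU1P[<-|qi0].
  rewrite mul0r !sub0r sqrrN expr2 mulfK ?gt_eqF//; lra.
have := @ln_le_subr1 R (q i / p i); rewrite divr_gt0// => /(_ isT) h.
have : q i * ln (q i / p i) <= q i * (q i / p i - 1) by rewrite ler_pM2l.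
move=> /le_trans; apply; rewrite le_eqVlt; apply/orP; left; apply/eqP.
by field; rewrite gt_eqF.
Qed.

(** The difference of the two sides is the variance of [x] under [m]. *)
Lemma sqr_mean_le (J : finType) (m x : J -> R) :
  (forall j, 0 <= m j) -> \sum_j m j = 1 ->
  (\sum_j m j * x j) ^+ 2 <= \sum_j m j * x j ^+ 2.
Proof.
move=> m0 m1; set s := \sum_j m j * x j.
have : 0 <= \sum_j m j * (x j - s) ^+ 2.
  by apply: sumr_ge0 => j _; rewrite mulr_ge0 ?sqr_ge0.
rewrite (eq_bigr (fun j => m j * x j ^+ 2 - m j * x j * (2 * s) + m j * s ^+ 2)).
  by rewrite big_split/= sumrB -!mulr_suml m1 -/s; lra.
by move=> j _; ring.
Qed.

Lemma vec_chi2_ge0 q p : prob_vec p -> 0 <= vec_chi2 q p.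
Proof. by move=> [p0 _]; apply: sumr_ge0 => i _; rewrite divr_ge0 ?sqr_ge0. Qed.

Lemma vec_chi2_convex (J : finType) (m : J -> R) (r : J -> I -> R) p (M : R) :
  prob_vec p -> (forall j, 0 <= m j) -> \sum_j m j = 1 ->
  (forall j, vec_chi2 (r j) p <= M) ->
  vec_chi2 (fun i => \sum_j m j * r j i) p <= M.
Proof.
move=> [p0 _] m0 m1 rM.
apply: (@le_trans _ _ (\sum_j m j * vec_chi2 (r j) p)); last first.
  have -> : M = \sum_j m j * M by rewrite -mulr_suml m1 mul1r.
  by apply: ler_sum => j _; rewrite ler_wpM2l.
under [leRHS]eq_bigr do rewrite mulr_sumr.
rewrite exchange_big/=; apply: ler_sum => i _.
have -> : \sum_j m j * ((r j i - p i) ^+ 2 / p i) =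
    (\sum_j m j * (r j i - p i) ^+ 2) / p i.
  by rewrite mulr_suml; apply: eq_bigr => j _; rewrite mulrA.
rewrite ler_wpM2r ?invr_ge0//; apply: le_trans (sqr_mean_le _ m0 m1).
rewrite le_eqVlt; apply/orP; left; apply/eqP; congr (_ ^+ 2).
under [RHS]eq_bigr do rewrite mulrBr.
by rewrite sumrB -mulr_suml m1 mul1r.
Qed.

End finite_transport.

(** * Mixtures of finitely many vectors *)

Section finite_mixture.
Context (R : realType) (I J : finType) (m : J -> R) (p : J -> I -> R).
Hypotheses (m_prob : prob_vec m) (p_prob : forall j, prob_vec (p j)).

Definition vec_mixture (i : I) := \sum_j m j * p j i.

Lemma prob_vec_mixture : prob_vec vec_mixture.
Proof.
have [m0 m1] := m_prob; split.
  by move=> i; apply: sumr_ge0 => j _; rewrite mulr_ge0//; have [->] := p_prob j.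
rewrite exchange_big/= -m1; apply: eq_bigr => j _.
by rewrite -mulr_sumr; have [_ ->] := p_prob j; rewrite mulr1.
Qed.

(** The chain rule of entropy for the density [f = q / vec_mixture], with
    [z j = \sum_i f i * p j i] and [r j = f * p j / z j].  The entropy of [z]
    relative to [m] is replaced by its quadratic lower bound. *)
Lemma vec_mixture_disintegration q : prob_vec q -> abs_cont q vec_mixture ->
  exists (z : J -> R) (r : J -> I -> R),
    [/\ [/\ forall j, 0 <= z j, \sum_j m j * z j = 1 &
         forall i, q i = \sum_j m j * z j * r j i],
        forall j, prob_vec (r j) /\ abs_cont (r j) (p j) &
        \sum_j m j * z j * vec_entropy (r j) (p j) +
          2^-1 * (\sum_j m j * Num.max 0 (1 - z j) ^+ 2) <=
          vec_entropy q vec_mixture].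
Proof.
move=> [q0 q1] qmix; have [m0 m1] := m_prob.
have [mix0 mix1] := prob_vec_mixture.
pose f i := q i / vec_mixture i; pose z j := \sum_i f i * p j i.
have f0 i : 0 <= f i by rewrite divr_ge0.
have p0 j i : 0 <= p j i by have [->] := p_prob j.
have fp0 j i : 0 <= f i * p j i by rewrite mulr_ge0.
have z0 j : 0 <= z j by rewrite sumr_ge0.
pose r j i := if z j == 0 then p j i else f i * p j i / z j.
have qE i : q i = f i * vec_mixture i.
  have [m_0|mn0] := eqVneq (vec_mixture i) 0; first by rewrite m_0 mulr0 qmix.
  by rewrite /f divfK.
have zr j i : z j * r j i = f i * p j i.
  rewrite /r; case: eqVneq => [zj|zj]; last by rewrite mulrCA mulfV ?mulr1.
  move/eqP : (zj); rewrite psumr_eq0// => /allP/(_ i).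
  by rewrite mem_index_enum => /(_ isT)/eqP ->; rewrite zj mul0r.
have mz : \sum_j m j * z j = 1.
  rewrite -q1; under eq_bigr do rewrite mulr_sumr.
  rewrite exchange_big/=; apply: eq_bigr => i _.
  by rewrite qE mulr_sumr; apply: eq_bigr => j _; rewrite mulrCA.
exists z, r; split.
- split=> // i; rewrite qE mulr_sumr; apply: eq_bigr => j _.
  by rewrite -mulrA zr mulrCA.
- move=> j; split; last first.
    by move=> i pji; rewrite /r pji mulr0 mul0r; case: ifP.
  split=> [i|].
    by rewrite /r; case: ifP => // _; rewrite divr_ge0.
  rewrite /r; case: eqVneq => [zj|zj]; first by have [_ ->] := p_prob j.
  by rewrite -mulr_suml mulfV.
have entj j : \sum_i f i * p j i * ln (f i) =
    z j * vec_entropy (r j) (p j) + z j * ln (z j).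
  have [zj|zj] := eqVneq (z j) 0.
    rewrite zj !mul0r addr0; apply: big1 => i _.
    by rewrite -zr zj !mul0r.
  have zgt : 0 < z j by rewrite lt_neqAle eq_sym zj z0.
  have -> : z j * ln (z j) = \sum_i f i * p j i * ln (z j) by rewrite mulr_suml.
  rewrite /vec_entropy mulr_sumr -big_split/=.
  apply: eq_bigr => i _; rewrite mulrA zr -mulrDr.
  have [-> |fpn0] := eqVneq (f i * p j i) 0; first by rewrite !mul0r.
  have /andP[fn0 pn0] : (f i != 0) && (p j i != 0) by rewrite -negb_or -mulf_eq0.
  have fgt : 0 < f i by rewrite lt_neqAle eq_sym fn0 f0.
  congr (_ * _); rewrite /r (negbTE zj).
  rewrite [f i * _ / _ / _](_ : _ = f i / z j); last by field; rewrite zj pn0.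
  by rewrite ln_div ?posrE// subrK.
have -> : vec_entropy q vec_mixture =
    \sum_j m j * (z j * vec_entropy (r j) (p j) + z j * ln (z j)).
  under [RHS]eq_bigr do rewrite -entj mulr_sumr.
  rewrite exchange_big/=; apply: eq_bigr => i _.
  rewrite -/(f i) {1}qE /vec_mixture mulr_sumr mulr_suml.
  by apply: eq_bigr => j _; rewrite [f i * _]mulrCA !mulrA.
have mz1 : \sum_j m j * (z j - 1) = 0.
  under eq_bigr do rewrite mulrBr mulr1.
  by rewrite sumrB mz m1 subrr.
rewrite -[leLHS]addr0 -[X in _ + X <= _]mz1 mulr_sumr -!big_split/=; apply: ler_sum => j _.
have := ler_wpM2l (m0 j) (xlnx_ge_quad (z0 j)).
by lra.
Qed.

(** Components with [z j < 1] give the fraction [1 - z j] of their mass to the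
    average of the components with [z j > 1]; this changes the mixture with
    weights [m] into the one with weights [m z], while the components move only
    by [1 - z j] in chi-square distance. *)
Lemma vec_mixture_rebalance (M : R) (z : J -> R) :
  (forall j j', abs_cont (p j) (p j')) ->
  (forall j j', vec_chi2 (p j) (p j') <= M) ->
  (forall j, 0 <= z j) -> \sum_j m j * z j = 1 ->
  exists r : J -> I -> R,
    [/\ forall j, prob_vec (r j) /\ abs_cont (r j) (p j),
        forall i, \sum_j m j * r j i = \sum_j m j * z j * p j i &
        forall j, vec_chi2 (r j) (p j) <= M * Num.max 0 (1 - z j) ^+ 2].
Proof.
move=> pp chiM z0 mz; have [m0 m1] := m_prob.
pose u j : R := Num.max 0 (1 - z j); pose v j : R := Num.max 0 (z j - 1).
have u0 j : 0 <= u j by rewrite le_max lexx.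
have v0 j : 0 <= v j by rewrite le_max lexx.
have u1 j : u j <= 1 by rewrite ge_max ler01/= gerBl.
have vu j : v j - u j = z j - 1.
  rewrite /u /v; case: (leP 0 (z j - 1)) => h.
    by rewrite (max_l (_ : 1 - z j <= 0)); lra.
  by rewrite max_r; lra.
pose tau := \sum_j m j * v j.
have tau_u : \sum_j m j * u j = tau.
  apply/esym/eqP; rewrite -subr_eq0 /tau -sumrB; apply/eqP.
  under eq_bigr do rewrite -mulrBr vu mulrBr mulr1.
  by rewrite sumrB mz m1 subrr.
have tau0 : 0 <= tau by apply: sumr_ge0 => j _; rewrite mulr_ge0.
have M0 (j : J) : 0 <= M by apply: le_trans (chiM j j); exact: vec_chi2_ge0.
have [tau_0|taun0] := eqVneq tau 0.
  have mu0 j : m j * u j = 0.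
    move/eqP : (tau_u); rewrite tau_0 psumr_eq0 => [/allP/(_ j)|k _].
      by rewrite mem_index_enum => /(_ isT)/eqP.
    by rewrite mulr_ge0.
  have mv0 j : m j * v j = 0.
    move/eqP : tau_0; rewrite psumr_eq0 => [/allP/(_ j)|k _].
      by rewrite mem_index_enum => /(_ isT)/eqP.
    by rewrite mulr_ge0.
  exists p; split => [j|i|j]; first by split.
    apply: eq_bigr => j _; congr (_ * _).
    have h : m j * (z j - 1) = 0 by rewrite -vu mulrBr mv0 mu0 subrr.
    by apply/eqP; rewrite eq_sym -subr_eq0 -[X in _ - X]mulr1 -mulrBr h.
  rewrite /vec_chi2 big1 => [|i _]; last by rewrite subrr expr0n mul0r.
  by rewrite mulr_ge0 ?sqr_ge0 ?(M0 j).
pose s i := \sum_j (m j * v j / tau) * p j i.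
have w0 j : 0 <= m j * v j / tau by rewrite divr_ge0 ?mulr_ge0.
have w1 : \sum_j m j * v j / tau = 1 by rewrite -mulr_suml divff.
have p0 j i : 0 <= p j i by have [->] := p_prob j.
have s0 i : 0 <= s i by apply: sumr_ge0 => j _; rewrite mulr_ge0.
have s1 : \sum_i s i = 1.
  rewrite exchange_big/= -w1; apply: eq_bigr => j _.
  by rewrite -mulr_sumr; have [_ ->] := p_prob j; rewrite mulr1.
have schi j : vec_chi2 s (p j) <= M.
  exact: vec_chi2_convex.
exists (fun j i => p j i + u j * (s i - p j i)); split.
- move=> j; split; last first.
    move=> i pji; rewrite pji add0r subr0 /s big1 ?mulr0// => k _.
    by rewrite (pp k j i pji) mulr0.
  split=> [i|].
    rewrite (_ : _ + _ = (1 - u j) * p j i + u j * s i); last by ring.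
    by rewrite addr_ge0// mulr_ge0// subr_ge0.
  rewrite big_split/= -mulr_sumr sumrB s1; have [_ ->] := p_prob j.
  by rewrite subrr mulr0 addr0.
- move=> i.
  under eq_bigr do rewrite mulrDr mulrBr mulrBr mulrA.
  rewrite big_split/= sumrB -mulr_suml tau_u.
  have -> : tau * s i = \sum_j m j * v j * p j i.
    rewrite /s mulr_sumr; apply: eq_bigr => j _; field; exact: taun0.
  rewrite -sumrB -big_split/=; apply: eq_bigr => j _.
  by rewrite (_ : z j = 1 + (v j - u j)); [ring|rewrite vu; ring].
- move=> j; rewrite mulrC.
  apply: (@le_trans _ _ (u j ^+ 2 * vec_chi2 s (p j))); last first.
    by rewrite ler_wpM2l// sqr_ge0.
  rewrite /vec_chi2 mulr_sumr; apply: ler_sum => i _.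
  by rewrite addrAC subrr add0r exprMn mulrA.
Qed.

(** The mixture of the [p j] with weights [m] goes to the one with weights
    [m z] along the plans from [p j] to its rebalanced version, and then to [q]
    along the plans from [p j] to [r j].  The chain rule bounds the total cost. *)
Lemma finite_mixture_transport (a : I -> I -> R) (C M e : R) :
  (forall i k l, a i l <= 2 * (a i k + a k l)) ->
  0 <= C ->
  (forall j j', abs_cont (p j) (p j')) ->
  (forall j j', vec_chi2 (p j) (p j') <= M) ->
  (forall j r, prob_vec r -> abs_cont r (p j) ->
    transportable a (p j) r (C * vec_entropy r (p j) + e)) ->
  forall q, prob_vec q -> abs_cont q vec_mixture ->
  transportable a vec_mixture q
    (2 * Num.max 1 (2 * M) * C * vec_entropy q vec_mixture + 4 * e).
Proof.
move=> tri C0 pp chiM pT q qprob qmix; have [m0 m1] := m_prob.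
have [z [r [[z0 mz qE] rp entq]]] := vec_mixture_disintegration qprob qmix.
have [s [sp sE schi]] := vec_mixture_rebalance pp chiM z0 mz.
have T1 : transportable a vec_mixture (fun i => \sum_j m j * z j * p j i)
    (\sum_j m j * (C * (M * Num.max 0 (1 - z j) ^+ 2) + e)).
  rewrite [X in transportable _ _ X](_ : _ = fun i => \sum_j m j * s j i).
    apply: transport_mixture => // j; have [sj spj] := sp j.
    apply: transportable_le (pT j _ sj spj).
    rewrite lerD2r ler_wpM2l//; apply: le_trans (schi j).
    exact: vec_entropy_le_chi2.
  by apply/funext => i; rewrite sE.
have T2 : transportable a (fun i => \sum_j m j * z j * p j i) q
    (\sum_j m j * z j * (C * vec_entropy (r j) (p j) + e)).
  rewrite [X in transportable _ _ X](_ : q = fun i => \sum_j m j * z j * r j i).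
    apply: transport_mixture => j; first by rewrite mulr_ge0.
    by have [rj rpj] := rp j; exact: pT.
  by apply/funext => i; rewrite qE.
apply: transportable_le (transport_glue tri T1 T2).
have -> : \sum_j m j * (C * (M * Num.max 0 (1 - z j) ^+ 2) + e) =
    C * M * (\sum_j m j * Num.max 0 (1 - z j) ^+ 2) + e.
  under eq_bigr do rewrite mulrDr.
  rewrite big_split/= -mulr_suml m1 mul1r mulr_sumr; congr (_ + _).
  by apply: eq_bigr => j _; ring.
have -> : \sum_j m j * z j * (C * vec_entropy (r j) (p j) + e) =
    C * (\sum_j m j * z j * vec_entropy (r j) (p j)) + e.
  under eq_bigr do rewrite mulrDr.
  rewrite big_split/= -mulr_suml mz mul1r mulr_sumr; congr (_ + _).
  by apply: eq_bigr => j _; ring.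
set S1 := \sum_j m j * z j * _ in entq *; set S2 := \sum_j m j * _ in entq *.
set K := Num.max 1 (2 * M).
have S10 : 0 <= S1.
  apply: sumr_ge0 => j _; rewrite !mulr_ge0//.
  by have [rj rpj] := rp j; exact: vec_entropy_ge0.
have S20 : 0 <= S2 by apply: sumr_ge0 => j _; rewrite mulr_ge0// sqr_ge0.
have K1 : 1 <= K by rewrite le_max lexx.
have KM : 2 * M <= K by rewrite le_max lexx orbT.
have h1 : S1 <= K * S1 by rewrite ler_peMl.
have h2 : 2 * M * S2 <= K * S2 by rewrite ler_wpM2r.
have h3 : K * (S1 + 2^-1 * S2) <= K * vec_entropy q vec_mixture.
  by rewrite ler_wpM2l//; lra.
have h4 : C * (S1 + M * S2) <= C * (K * vec_entropy q vec_mixture).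
  by rewrite ler_wpM2l//; lra.
by lra.
Qed.

End finite_mixture.

Section perturbation.
Context (R : realType) (I : finType).

(** [p] is a convex combination of [p'], with weight [(1 + e)^-1], and of another
    probability vector, which is coupled with [q] independently. *)
Lemma transport_perturb (a : I -> I -> R) (A e B : R) (p p' q : I -> R) :
  (forall i j, 0 <= a i j <= A) -> 0 <= A -> 0 < e ->
  prob_vec p -> prob_vec p' -> prob_vec q ->
  (forall i, p' i <= (1 + e) * p i) ->
  transportable a p' q B -> transportable a p q (B + e * A).
Proof.
move=> aA A0 e0 [p0 p1] [p'0 p'1] [q0 q1] p'p [w [w0 wp wq] cw].
have e1 : 0 < 1 + e by lra.
have e1n : 1 + e != 0 by rewrite gt_eqF.
have d0 i : 0 <= p i - p' i / (1 + e).
  by rewrite subr_ge0 ler_pdivrMr// mulrC.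
have d1 : \sum_i (p i - p' i / (1 + e)) = e / (1 + e).
  by rewrite sumrB p1 -mulr_suml p'1; field.
exists (fun i j => w i j / (1 + e) + (p i - p' i / (1 + e)) * q j).
  split.
  - move=> i j; apply: addr_ge0; last exact: mulr_ge0.
    by apply: divr_ge0 => //; exact: ltW.
  - by move=> i; rewrite big_split/= -mulr_suml wp -mulr_sumr q1; ring.
  - by move=> j; rewrite big_split/= -mulr_suml wq -mulr_suml d1; field.
rewrite /plan_cost.
under eq_bigr do under eq_bigr do rewrite mulrDr.
under eq_bigr do rewrite big_split/=.
rewrite big_split/=; apply: lerD.
  apply: le_trans cw; apply: ler_sum => i _; apply: ler_sum => j _.
  have /andP[aij _] := aA i j; rewrite ler_wpM2l// ler_pdivrMr// ler_peMr//; lra.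
apply: (@le_trans _ _ (\sum_i \sum_j A * ((p i - p' i / (1 + e)) * q j))).
  apply: ler_sum => i _; apply: ler_sum => j _.
  by have /andP[_ h] := aA i j; rewrite ler_wpM2r// mulr_ge0.
under eq_bigr do rewrite -!mulr_sumr q1 mulr1.
rewrite -mulr_sumr d1 mulrC ler_wpM2r// ler_pdivrMr// ler_peMr//; lra.
Qed.

Lemma vec_entropy_perturb (e : R) (q p p' : I -> R) : 0 < e -> e < 1 ->
  prob_vec q -> (forall i, 0 <= p i) -> abs_cont q p ->
  (forall i, (1 - e) * p i <= p' i) ->
  vec_entropy q p' <= vec_entropy q p - ln (1 - e).
Proof.
move=> e0 e1 [q0 q1] p0 qp pp'.
have -> : - ln (1 - e) = \sum_i q i * - ln (1 - e) by rewrite -mulr_suml q1 mul1r.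
rewrite -big_split/=; apply: ler_sum => i _; rewrite -mulrDr.
have := q0 i; rewrite le_eqVlt => /predU1P[<-|qi0]; first by rewrite !mul0r.
have pi0 : 0 < p i.
  by rewrite lt_neqAle p0 andbT eq_sym; apply/eqP => /qp/eqP; rewrite gt_eqF.
have e'0 : 0 < 1 - e by rewrite subr_gt0.
have p'i0 : 0 < p' i by apply: lt_le_trans (pp' i); rewrite mulr_gt0.
rewrite ler_wpM2l// -ln_div ?posrE ?divr_gt0// ler_ln ?posrE ?divr_gt0//.
rewrite -mulrA -invfM ler_wpM2l// lef_pV2 ?posrE ?mulr_gt0// mulrC; exact: pp'.
Qed.

End perturbation.

(** * The cost function *)

(** What the proof uses of the cost on the line.  The inequality [ql_add] is the
    usual one for squares. *)
Record quadratic_like (R : realType) (alpha : R -> R) : Prop := QuadraticLike {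
  ql_ge0 : forall t, 0 <= alpha t;
  ql_sym : forall t, alpha (- t) = alpha t;
  ql_0 : alpha 0 = 0;
  ql_le : forall s t, `|s| <= `|t| -> alpha s <= alpha t;
  ql_add : forall s a b, 0 < s -> s < 1 ->
    alpha (a + b) <= alpha a / (1 - s) + alpha b / s;
  ql_continuous : continuous alpha }.

Section scalar_cost.
Context (R : realType) (alpha : R -> R).
Hypotheses (alpha_ge0 : forall t, 0 <= alpha t)
  (alpha_sym : forall t, alpha (- t) = alpha t)
  (alpha_convex : convex_function [set: R^o] alpha)
  (alpha_derivable : forall t, derivable alpha t 1)
  (alpha0 : alpha 0 = 0)
  (alpha'_concave : convex_function (`[0, +oo[%classic : set R^o)
    (fun t => - alpha^`()%classic t)).

Lemma cost_convex s a b : 0 <= s -> s <= 1 ->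
  alpha (s * a + (1 - s) * b) <= s * alpha a + (1 - s) * alpha b.
Proof.
move=> s0 s1; have := alpha_convex (Itv01 s0 s1) (mem_set (I : setT a))
  (mem_set (I : setT b)).
by rewrite !convRE.
Qed.

Lemma cost_le s t : `|s| <= `|t| -> alpha s <= alpha t.
Proof.
have abs x : alpha `|x| = alpha x by case: (ger0P x).
have main (u v : R) : 0 <= u -> u <= v -> alpha u <= alpha v.
  move=> u0 uv; have [v0|v0] := leP v 0.
    by rewrite (_ : u = v)//; apply/eqP; rewrite eq_le uv (le_trans v0).
  have vn0 : v != 0 by rewrite gt_eqF.
  (* [u] lies between [v] and [- v], where [alpha] takes the same value *)
  have := @cost_convex ((1 + u / v) / 2) v (- v).
  have uv1 : u / v <= 1 by rewrite ler_pdivrMr ?mul1r.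
  have uv0 : 0 <= u / v by rewrite divr_ge0// ltW.
  rewrite alpha_sym (_ : _ + _ * - v = u); last by field.
  rewrite -mulrDl [_ / 2 + _]addrC subrK mul1r; apply; lra.
by move=> st; rewrite -(abs s) -(abs t); exact: main.
Qed.

Lemma cost_derive0 : alpha^`()%classic 0 = 0.
Proof.
rewrite derive1E; have : is_derive (0 : R) 1 alpha 0.
  apply: (@derive1_at_min R alpha (- 1) 1 0).
  - by apply: (@le_trans _ _ 0); rewrite ?oppr_le0 ?ler01.
  - by move=> t _; exact: alpha_derivable.
  - by rewrite in_itv/= oppr_lt0 ltr01.
  - by move=> t _; rewrite alpha0.
by move=> d; rewrite derive_val.
Qed.

(** As functions of [t], the two sides agree at 0, and their difference has derivative
    [l * (alpha' (l t) - l * alpha' t)], which is nonpositive because [alpha'] is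
    concave and vanishes at 0. *)
Lemma cost_scale l t : 1 <= l -> alpha (l * t) <= l ^+ 2 * alpha t.
Proof.
move=> l1; have l0 : 0 < l by lra.
have abs x : alpha `|x| = alpha x by case: (ger0P x).
have abs2 : alpha (l * `|t|) = alpha (l * t).
  by rewrite -[RHS]abs normrM (gtr0_norm l0).
suff main (u : R) : 0 <= u -> alpha (l * u) <= l ^+ 2 * alpha u.
  by rewrite -(abs t) -abs2; exact: main.
move=> u0.
pose G : R -> R := (alpha \o ( *%R l)) - (l ^+ 2 \*: alpha).
have dG (x : R) : is_derive x 1 G (alpha^`()%classic (l * x) * l - l ^+ 2 * alpha^`()%classic x).
  have d1 (y : R) : is_derive y 1 alpha (alpha^`()%classic y).
    by rewrite derive1E; apply: derivableP.
  have d2 : is_derive x 1 ( *%R l) l.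
    have : is_derive x 1 (l \*: (@id R)) (l *: 1) by apply: is_deriveZ.
    by rewrite /GRing.scale/= mulr1.
  exact: is_deriveB.
suff : G u <= G 0.
  by rewrite /G/= /GRing.add/= /GRing.opp/= /GRing.scale/= mulr0 alpha0 mulr0 subrr subr_le0.
apply: (@ler0_derive1_nincry _ G 0 _ _ _ 0 u (lexx 0) u0).
- by move=> x _; have [] := dG x.
- move=> x; rewrite in_itv/= andbT => x0; rewrite derive1E; have := dG x.
  move=> dGx; rewrite derive_val.
  have li0 : 0 <= l^-1 by rewrite invr_ge0 ltW.
  have li1 : l^-1 <= 1 by rewrite invf_le1.
  have m1 : l * x \in (`[0, +oo[%classic : set R^o).
    by rewrite inE/= in_itv/= andbT mulr_ge0// ltW.
  have m0 : 0 \in (`[0, +oo[%classic : set R^o) by rewrite inE/= in_itv/= lexx.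
  have : - alpha^`()%classic (l^-1 * (l * x) + (1 - l^-1) * 0) <=
      l^-1 * (- alpha^`()%classic (l * x)) + (1 - l^-1) * (- alpha^`()%classic 0).
    exact: (alpha'_concave (Itv01 li0 li1) m1 m0).
  rewrite !mulr0 addr0 mulKf ?gt_eqF// cost_derive0 oppr0 mulr0 addr0.
  rewrite mulrN lerN2 ler_pdivrMl// => h.
  have := ler_wpM2l (ltW l0) h; lra.
- by apply: derivable_within_continuous => x _; have [] := dG x.
Qed.

(** Convexity applied to [a + b = (1 - s) (a / (1 - s)) + s (b / s)], followed by
    [cost_scale]. *)
Lemma cost_add s a b : 0 < s -> s < 1 ->
  alpha (a + b) <= alpha a / (1 - s) + alpha b / s.
Proof.
move=> s0 s1; have s'0 : 0 < 1 - s by lra.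
have sn0 : s != 0 by rewrite gt_eqF.
have s'n0 : 1 - s != 0 by rewrite gt_eqF.
have -> : a + b = s * (s^-1 * b) + (1 - s) * ((1 - s)^-1 * a).
  by rewrite !mulrA !mulfV// !mul1r addrC.
apply: le_trans (cost_convex _ _ (ltW s0) (ltW s1)) _; rewrite addrC.
have si1 : 1 <= s^-1 by rewrite invf_ge1// ltW.
have s'i1 : 1 <= (1 - s)^-1 by rewrite invf_ge1//; lra.
apply: lerD.
  apply: le_trans (ler_wpM2l (ltW s'0) (cost_scale a s'i1)) _.
  by rewrite expr2 !mulrA mulfV// mul1r mulrC.
apply: le_trans (ler_wpM2l (ltW s0) (cost_scale b si1)) _.
by rewrite expr2 !mulrA mulfV// mul1r mulrC.
Qed.

Lemma quadratic_like_cost : quadratic_like alpha.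
Proof.
split=> //; [exact: cost_le|exact: cost_add|].
by move=> t; apply/differentiable_continuous/derivable1_diffP.
Qed.

End scalar_cost.

Section vector_cost.
Context (R : realType) (d : nat) (alpha : R -> R).
Hypothesis alphaP : quadratic_like alpha.
Local Notation c := (@sum_cost R d alpha).
Implicit Types x y : 'rV[R]_d.

Lemma sum_cost_ge0 x : 0 <= c x.
Proof. by apply: sumr_ge0 => i _; exact: ql_ge0. Qed.

Lemma sum_cost_opp x : c (- x) = c x.
Proof. by apply: eq_bigr => i _; rewrite mxE ql_sym. Qed.

Lemma sum_cost_le x y : (forall i, `|x ord0 i| <= `|y ord0 i|) -> c x <= c y.
Proof. by move=> xy; apply: ler_sum => i _; exact: ql_le. Qed.

Lemma sum_cost_add s x y : 0 < s -> s < 1 ->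
  c (x + y) <= c x / (1 - s) + c y / s.
Proof.
move=> s0 s1; rewrite /sum_cost !mulr_suml -big_split/=.
by apply: ler_sum => i _; rewrite mxE; exact: ql_add.
Qed.

Lemma sum_cost_add2 x y : c (x + y) <= 2 * (c x + c y).
Proof.
have := @sum_cost_add 2^-1 x y; rewrite (_ : 1 - 2^-1 = 2^-1); last by field.
rewrite !invrK => h; apply: le_trans (h _ _) _; lra.
Qed.

(** A loss of [6 / 5] on the main term can be afforded twice in the final
    constant; the factor 6 falls on terms that tend to zero. *)
Lemma sum_cost_add_sixth x y : c (x + y) <= 6 / 5 * c x + 6 * c y.
Proof.
have h0 : 0 < 1 / 6 :> R by lra.
have h1 : 1 / 6 < 1 :> R by lra.
apply: le_trans (sum_cost_add x y h0 h1) _.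
by rewrite le_eqVlt; apply/orP; left; apply/eqP; field.
Qed.

Lemma sum_cost_bounded (e : R) x : (forall i, `|x ord0 i| <= `|e|) ->
  c x <= d%:R * alpha e.
Proof.
move=> xe; apply: (@le_trans _ _ (\sum_(i < d) alpha e)).
  by apply: ler_sum => i _; exact: ql_le.
by rewrite sumr_const card_ord mulr_natl.
Qed.

Lemma measurable_sum_cost (disp : measure_display) (Y : measurableType disp)
    (f : Y -> 'rV[R]_d) :
  (forall i, measurable_fun setT (fun u => f u ord0 i)) ->
  measurable_fun setT (fun u => c (f u)).
Proof.
move=> mf; apply: measurable_sum => i.
apply: (measurableT_comp (continuous_measurable_fun _) (mf i)).
exact: ql_continuous.
Qed.

Lemma sum_cost_cvg (f : nat -> 'rV[R]_d) x :
  (forall i, f n ord0 i @[n --> \oo] --> x ord0 i) ->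
  c (f n) @[n --> \oo] --> c x.
Proof.
move=> fx; apply: cvg_big => [|i _]; first exact: add_continuous.
by apply: continuous_cvg (fx i); exact: ql_continuous.
Qed.

End vector_cost.

(** * Rounding to a grid *)

Section grid_line.
Context (R : realType).
Implicit Types (a t u : R) (n : nat).

Definition clamp a t := Num.max (- a) (Num.min a t).

(** Reduces the facts below to linear arithmetic. *)
Lemma clampE a t : 0 <= a ->
  [\/ a <= t /\ clamp a t = a, t <= - a /\ clamp a t = - a |
      [/\ - a <= t, t <= a & clamp a t = t]].
Proof.
move=> a0; rewrite /clamp; have [at_|ta] := leP a t.
  by apply: Or31; split=> //; apply: max_r; lra.
have [nat_|tna] := leP (- a) t.
  by apply: Or33; split=> //; exact: ltW.
by apply: Or32; split=> //; exact: ltW.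
Qed.

Lemma clamp_bound a t : 0 <= a -> - a <= clamp a t <= a.
Proof. by move=> a0; case: (clampE t a0) => -[]; lra. Qed.

Lemma clamp_contract a t u : 0 <= a -> `|clamp a t - clamp a u| <= `|t - u|.
Proof.
move=> a0; case: (ger0P (t - u)) => tu; rewrite ler_norml; apply/andP; split;
 by case: (clampE t a0) => -[]; case: (clampE u a0) => -[]; lra.
Qed.

Lemma clamp_norm a t : 0 <= a -> `|clamp a t| <= `|t|.
Proof.
move=> a0; have := clamp_contract t 0 a0; rewrite subr0.
rewrite (_ : clamp a 0 = 0) ?subr0//; case: (clampE 0 a0) => -[]; lra.
Qed.

Lemma clamp_defect a t : 0 <= a -> `|t - clamp a t| <= `|t|.
Proof.
by move=> a0; case: (ger0P t) => tu; rewrite ler_norml; apply/andP; split;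
   case: (clampE t a0) => -[]; lra.
Qed.

Lemma clamp_id a t : `|t| <= a -> clamp a t = t.
Proof.
move=> ta; have a0 : 0 <= a by exact: le_trans ta.
move: ta; rewrite ler_norml => /andP[h1 h2].
by case: (clampE t a0) => -[]; lra.
Qed.

(** The grid has mesh [n.+1^-1] on [-n.+1, n.+1]; clamping first makes it finite
    and keeps rounding a contraction up to the mesh. *)
Definition grid_index n t : nat :=
  Num.truncn (n.+1%:R * (clamp n.+1%:R t + n.+1%:R)).

Definition grid_size n : nat := 2 * n.+1 * n.+1.

Definition grid_point n (k : nat) : R := k%:R / n.+1%:R - n.+1%:R.

Lemma grid_index_size n t : (grid_index n t < (grid_size n).+1)%N.
Proof.
have /andP[h1 h2] := @clamp_bound n.+1%:R t (ler0n _ _).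
rewrite ltnS /grid_index -(@natrK R (grid_size n)); apply: le_truncn.
rewrite /grid_size -mulnA [(2 * _)%N]mulnC !natrM -mulrA ler_wpM2l//; lra.
Qed.

Lemma grid_round_itv n t :
  0 <= clamp n.+1%:R t - grid_point n (grid_index n t) <= n.+1%:R^-1.
Proof.
have /andP[h1 h2] := @clamp_bound n.+1%:R t (ler0n _ _).
have n0 : 0 < n.+1%:R :> R by rewrite ltr0n.
have := @truncn_itv R (n.+1%:R * (clamp n.+1%:R t + n.+1%:R)).
rewrite mulr_ge0//; last lra.
move=> /(_ isT); rewrite -/(grid_index n t) => /andP[h3 /ltW h4].
rewrite /grid_point; set q := _ / _.
have qE : (grid_index n t)%:R = n.+1%:R * q by rewrite mulrC divfK ?gt_eqF.
move: h3; rewrite qE ler_pM2l// => h3.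
have nV : n.+1%:R * n.+1%:R^-1 = 1 :> R by rewrite mulfV ?gt_eqF.
move: h4; rewrite -[(grid_index n t).+1%:R]natr1 qE -[X in _ <= _ + X]nV -mulrDr ler_pM2l// => h4.
by rewrite opprB addrA subr_ge0 lerBlDr h3 [_^-1 + q]addrC.
Qed.

Lemma grid_index_homo n : {homo grid_index n : t u / t <= u >-> (t <= u)%N}.
Proof.
move=> t u tu; apply: le_truncn; rewrite ler_wpM2l// lerD2r.
have a0 : 0 <= n.+1%:R :> R by exact: ler0n.
case: (clampE t a0) => -[]; case: (clampE u a0) => -[]; lra.
Qed.

Lemma grid_round_cvg t :
  (fun n => grid_point n (grid_index n t)) @ \oo --> t.
Proof.
apply/cvgrPdist_le => e e0; near=> n.
have tn : `|t| <= n.+1%:R.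
  apply: (@le_trans _ _ n%:R); last by rewrite ler_nat.
  by near: n; exact: nbhs_infty_ger.
have := grid_round_itv n t; rewrite (clamp_id tn) => /andP[h1 h2].
rewrite ger0_norm//; apply: le_trans h2 _.
rewrite -[e]invrK lef_pV2 ?posrE ?invr_gt0//.
apply: (@le_trans _ _ n%:R); last by rewrite ler_nat.
by near: n; exact: nbhs_infty_ger.
Unshelve. all: by end_near. Qed.

End grid_line.

Section grid_space.
Context (R : realType) (d : nat).
Implicit Types (n : nat) (x y : 'rV[R]_d).

Definition cells n : finType := {ffun 'I_d -> 'I_(grid_size n).+1}.

Definition cell n x : cells n := [ffun i => inord (grid_index n (x ord0 i))].

Definition cell_point n (k : cells n) : 'rV[R]_d := \row_i grid_point R n (k i).

Lemma cell_pointE n x i :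
  cell_point (cell n x) ord0 i = grid_point R n (grid_index n (x ord0 i)).
Proof. by rewrite mxE ffunE inordK// grid_index_size. Qed.

(** The measurable sets of [Rd R d] are generated by the open sets, and
    coordinates are continuous. *)
Lemma measurable_coord i :
  measurable_fun setT (fun x : Rd R d => (x : 'rV[R]_d) ord0 i : R).
Proof.
apply: (measurability _ (RGenOpens.measurableE R)) => _ [_ [a [b ->] <-]].
rewrite setTI; apply: sub_sigma_algebra.
have /continuousP := @coord_continuous R 1 d ord0 i; apply.
exact: interval_open.
Qed.

Lemma measurable_cell n (k : cells n) : measurable [set x : Rd R d | cell n x = k].
Proof.
rewrite (_ : mkset _ = \bigcap_(i in [set: 'I_d])
    [set x : Rd R d | grid_index n ((x : 'rV[R]_d) ord0 i) = k i :> nat]).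
  apply: fin_bigcap_measurable => // i _.
  have mg : measurable_fun setT (fun x : Rd R d =>
      (grid_index n ((x : 'rV[R]_d) ord0 i))%:R : R).
    apply: (@measurableT_comp _ _ _ _ _ _ (fun t : R => (grid_index n t)%:R : R)).
      apply: nondecreasing_measurable => // t u tu.
      by rewrite ler_nat grid_index_homo.
    exact: measurable_coord.
  have := mg measurableT [set (k i)%:R] (measurable_set1 _).
  rewrite setTI; congr measurable; apply/seteqP; split => x /=.
    by move/eqP; rewrite eqr_nat => /eqP.
  by move=> ->.
apply/seteqP; split => [x /= <- i _|x /= h]; first by rewrite ffunE inordK// grid_index_size.
by apply/ffunP => i; apply: val_inj; rewrite /= ffunE inordK ?grid_index_size// h.
Qed.

End grid_space.

(** * Masses of the cells of a finite partition *)

Lemma probability_inhabited (disp : measure_display) (X : measurableType disp)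
  (R : realType) (P : probability X R) : [set: X] !=set0.
Proof.
apply/set0P/eqP => X0; have := probability_setT P.
by rewrite X0 measure0 => -[] /eqP; rewrite eq_sym oner_eq0.
Qed.

Section finite_partition.
Context (disp : measure_display) (X : measurableType disp) (R : realType).
Context (I : finType) (T : X -> I).
Hypothesis mT : forall k, measurable (T @^-1` [set k]).
Implicit Types (P : probability X R) (g : I -> R) (A : set X).

Definition cell_mass P k : R := fine (P (T @^-1` [set k])).

Lemma cell_massE P k : P (T @^-1` [set k]) = (cell_mass P k)%:E.
Proof. by rewrite fineK// fin_num_measure. Qed.

Lemma cell_mass_ge0 P k : 0 <= cell_mass P k.
Proof. by rewrite fine_ge0. Qed.

(** A function of the cell is simple, so integrals of such functions are finite
    sums over the cells. *)
Lemma comp_cellE g x : g (T x) = \sum_k g k * \1_(T @^-1` [set k]) x.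
Proof.
rewrite (bigD1 (T x))//= big1 => [|k kx].
  by rewrite indicE mem_set// mulr1 addr0.
by rewrite indicE memNset ?mulr0//= => /esym/eqP; rewrite (negbTE kx).
Qed.

Lemma measurable_comp_cell g : measurable_fun setT (g \o T).
Proof.
rewrite (_ : g \o T = fun x => \sum_k g k * \1_(T @^-1` [set k]) x).
  by apply: measurable_sum => k; apply: measurable_funM => //; exact: measurable_indic.
by apply/funext => x; exact: comp_cellE.
Qed.

Lemma integral_comp_cell P A g : measurable A ->
  (\int[P]_(x in A) (g (T x))%:E =
   \sum_k (g k)%:E * P (A `&` (T @^-1` [set k])))%E.
Proof.
move=> mA.
have int_indic k : P.-integrable A (EFin \o \1_(T @^-1` [set k]) : X -> \bar R).
  apply/integrableP; split.
    by apply/measurable_EFinP; exact: measurable_indic.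
  under eq_integral do rewrite /= ger0_norm//.
  by rewrite integral_indic// ltey_eq fin_num_measure//; exact: measurableI.
rewrite (eq_integral (fun x => \sum_k (g k)%:E * (EFin \o \1_(T @^-1` [set k])) x)%E).
  rewrite integral_sum//; last by move=> k; exact: integrableZl.
  by apply: eq_bigr => k _; rewrite integralZl// integral_indic// setIC.
by move=> x _; rewrite comp_cellE -sumEFin.
Qed.

Lemma integral_comp_cellT P g :
  (\int[P]_x (g (T x))%:E = (\sum_k g k * cell_mass P k)%:E)%E.
Proof.
rewrite integral_comp_cell// -sumEFin; apply: eq_bigr => k _.
by rewrite setTI cell_massE EFinM.
Qed.

Lemma sum_measure_cells P A : measurable A ->
  (\sum_k P (A `&` (T @^-1` [set k])) = P A)%E.
Proof.
move=> mA; have := @integral_comp_cell P A (fun=> 1) mA.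
rewrite integral_cst// mul1e => ->.
by apply: eq_bigr => k _; rewrite mul1e.
Qed.

Lemma prob_vec_cell_mass P : prob_vec (cell_mass P).
Proof.
split=> [k|]; first exact: cell_mass_ge0.
apply: EFin_inj; rewrite -(probability_setT P) -(sum_measure_cells _ measurableT).
by rewrite -sumEFin; apply: eq_bigr => k _; rewrite setTI cell_massE.
Qed.

Lemma cell_mass_dominates (P Q : probability X R) :
  P `<< Q -> abs_cont (cell_mass P) (cell_mass Q).
Proof.
move=> /null_content_dominatesP PQ k Qk; rewrite /cell_mass PQ//.
by apply: etrans (cell_massE Q k) _; rewrite Qk.
Qed.

Section reweighting.
Variables (P : probability X R) (v : I -> R).
Hypotheses (v0 : forall k, 0 <= v k) (v1 : \sum_k v k * cell_mass P k = 1).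

(** The proofs are arguments because the measure structure below depends on
    them. *)
Definition reweighting of (forall k, 0 <= v k) &
    \sum_k v k * cell_mass P k = 1 :=
  fun A : set X => (\int[P]_(x in A) (v (T x))%:E)%E.

Local Notation rew := (reweighting v0 v1).

Let reweighting0 : rew set0 = 0%E.
Proof. by rewrite /reweighting integral_set0. Qed.

Let reweighting_ge0 A : (0 <= rew A)%E.
Proof. by apply: integral_ge0 => x _; rewrite lee_fin. Qed.

Let reweighting_sigma_additive : semi_sigma_additive rew.
Proof.
apply: semi_sigma_additive_nng_induced => [|x]; last by rewrite lee_fin.
by apply/measurable_EFinP; exact: measurable_comp_cell.
Qed.

HB.instance Definition _ := isMeasure.Build _ _ _ rew
  reweighting0 reweighting_ge0 reweighting_sigma_additive.

Let reweighting_setT : rew setT = 1%E.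
Proof. by rewrite /reweighting integral_comp_cellT v1. Qed.

HB.instance Definition _ :=
  Measure_isProbability.Build _ _ _ rew reweighting_setT.

End reweighting.

Lemma reweighting_exists P (v : I -> R) : (forall k, 0 <= v k) ->
  \sum_k v k * cell_mass P k = 1 ->
  exists2 Q : probability X R,
    forall A, measurable A -> Q A = (\int[P]_(x in A) (v (T x))%:E)%E &
    forall k, cell_mass Q k = v k * cell_mass P k.
Proof.
move=> v0 v1; exists (reweighting v0 v1) => // k.
apply: EFin_inj; rewrite -cell_massE.
transitivity (\int[P]_(x in T @^-1` [set k]) (v (T x))%:E)%E => //.
rewrite integral_comp_cell// (bigD1 k)//= setIid big1 => [|l lk].
  by rewrite adde0 cell_massE -EFinM.
rewrite [X in P X](_ : _ = set0) ?measure0 ?mule0//.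
by apply/seteqP; split => // x [/= -> kl]; rewrite kl eqxx in lk.
Qed.

End finite_partition.

(** * Densities and tilted measures *)

Section integral_lemmas.
Context (disp : measure_display) (X : measurableType disp) (R : realType).
Local Open Scope ereal_scope.

(** No integrability is needed: in [\bar R] both parts of the integral are
    monotone, and so is their difference. *)
Lemma ae_le_integral (mu : {measure set X -> \bar R}) (f g : X -> \bar R) :
  measurable_fun setT f -> measurable_fun setT g ->
  {ae mu, forall x, f x <= g x} -> \int[mu]_x f x <= \int[mu]_x g x.
Proof.
move=> mf mg fg; rewrite integralE [leRHS]integralE; apply: leeB.
  apply: ae_ge0_le_integral => //; try exact: measurable_funepos.
  by apply: filterS fg => x h _; rewrite !funeposE ge_max !le_max h lexx orbT.
apply: ae_ge0_le_integral => //; try exact: measurable_funeneg.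
by apply: filterS fg => x h _; rewrite !funenegE ge_max !le_max leeN2 h lexx orbT.
Qed.

Lemma measurable_lne_comp (F : X -> R) : measurable_fun setT F ->
  measurable_fun setT (fun x => lne (F x)%:E).
Proof.
move=> mF; apply: measurable_fun_ifT.
- exact: measurable_fun_ler.
- exact: measurable_cst.
- by apply/measurable_EFinP; apply: measurableT_comp mF; exact: measurable_ln.
Qed.

End integral_lemmas.

Section density_facts.
Context (disp : measure_display) (X : measurableType disp) (R : realType).
Variables (P Q : probability X R).
Hypothesis QP : Q `<< P.
Local Open Scope ereal_scope.

(** A version of the density that is real-valued and nonnegative everywhere, which
    spares side conditions in what follows. *)
Lemma density_real : exists F : X -> R,
  [/\ (forall x, 0 <= F x)%R, measurable_fun setT F,
      forall h : X -> R, (forall x, 0 <= h x)%R -> measurable_fun setT h ->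
        \int[P]_x (h x * F x)%:E = \int[Q]_x (h x)%:E,
      ae_eq P setT (density Q P) (EFin \o F) &
      ae_eq Q setT (density Q P) (EFin \o F)].
Proof.
pose g := Radon_Nikodym_SigmaFinite.f Q P.
have g0 x : 0 <= g x by exact: Radon_Nikodym_SigmaFinite.f_ge0.
have gfin x : g x \is a fin_num by exact: Radon_Nikodym_SigmaFinite.f_fin_num.
have mg : measurable_fun setT g.
  exact: measurable_int (Radon_Nikodym_SigmaFinite.f_integrable QP).
have gE : g = EFin \o (fine \o g) by apply/funext => x /=; rewrite fineK.
have densE : ae_eq P setT (density Q P) (EFin \o (fine \o g)).
  by rewrite -gE; apply: ae_eq_sym; exact: ae_eq_Radon_Nikodym_SigmaFinite.
exists (fine \o g); split=> //.
- by move=> x; rewrite fine_ge0.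
- by apply/measurable_EFinP; rewrite -gE.
- move=> h h0 mh; rewrite -(Radon_Nikodym_SigmaFinite.change_of_variables QP)//.
  + by apply: eq_integral => x _; rewrite EFinM /= fineK.
  + exact/measurable_EFinP.
- exact: null_dominates_ae_eq densE.
Qed.

Lemma measurable_density : measurable_fun setT (density Q P).
Proof. exact: measurable_int (Radon_Nikodym_integrable _). Qed.

Lemma entropy_density (F : X -> R) : measurable_fun setT F ->
  ae_eq Q setT (density Q P) (EFin \o F) ->
  relative_entropy Q P = \int[Q]_x lne (F x)%:E.
Proof.
move=> mF dF; rewrite /relative_entropy asboolT//.
have dE : density Q P = EFin \o (fine \o density Q P).
  by apply/funext => x /=; rewrite fineK//; exact: Radon_Nikodym_fin_num.
apply: ae_eq_integral => //.
- rewrite dE; apply: measurable_lne_comp.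
  by apply/measurable_EFinP; rewrite -dE; exact: measurable_density.
- exact: measurable_lne_comp.
- by apply: filterS dF => x /= h /h ->.
Qed.

End density_facts.

Section divergences_of_cells.
Context (disp : measure_display) (X : measurableType disp) (R : realType).
Context (I : finType) (T : X -> I).
Hypothesis mT : forall k, measurable (T @^-1` [set k]).
Implicit Types (P Q : probability X R) (g : I -> R) (A : set X).
Local Notation mass := (cell_mass T).

(** Every vector of masses dominated by that of [P] is the image of a measure
    with the same entropy relative to [P]: its density is constant on cells. *)
Lemma tilt_exists P (r : I -> R) : prob_vec r -> abs_cont r (mass P) ->
  exists2 Q : probability X R, mass Q =1 r &
    relative_entropy Q P = (vec_entropy r (mass P))%:E.
Proof.
move=> [r0 r1] rP; pose v k := r k / mass P k.
have v0 k : 0 <= v k by rewrite divr_ge0// cell_mass_ge0.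
have vP k : v k * mass P k = r k.
  have [Pk|Pk] := eqVneq (mass P k) 0; first by rewrite Pk mulr0 rP.
  by rewrite divfK.
have [|Q QE Qv] := reweighting_exists mT (P := P) v0.
  by rewrite -r1; apply: eq_bigr => k _; exact: vP.
have mv : measurable_fun setT (EFin \o (v \o T)).
  by apply/measurable_EFinP; exact: measurable_comp_cell.
have QP : Q `<< P.
  apply/null_content_dominatesP => A mA PA; rewrite QE//.
  by apply: null_set_integral => //; exact: measurable_funTS.
have Qr k : mass Q k = r k by rewrite Qv vP.
exists Q => //.
have dens : ae_eq Q setT (density Q P) (EFin \o (v \o T)).
  apply: (null_dominates_ae_eq _ QP) => //.
  apply: integral_ae_eq => //; first exact: Radon_Nikodym_integrable.
  by move=> A _ mA; rewrite -Radon_Nikodym_integral//; exact: QE.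
have vpos : {ae Q, forall x, 0 < v (T x)}.
  exists (T @^-1` [set k | v k = 0]); split.
  - rewrite (_ : _ @^-1` _ = (v \o T) @^-1` [set 0])//.
    by rewrite -[X in measurable X]setTI; apply: measurable_comp_cell.
  - rewrite QE; last first.
      rewrite (_ : _ @^-1` _ = (v \o T) @^-1` [set 0])//.
      by rewrite -[X in measurable X]setTI; apply: measurable_comp_cell.
    by apply: integral0_eq => x /= ->.
  - by move=> x /= /negP; rewrite -leNgt => vx; apply/eqP; rewrite eq_le vx v0.
rewrite (entropy_density QP _ dens); last exact: measurable_comp_cell.
rewrite (ae_eq_integral (fun x => (ln (v (T x)))%:E))//.
- rewrite (integral_comp_cellT mT Q (fun k => ln (v k))); congr (_%:E).
  by apply: eq_bigr => k _; rewrite Qr mulrC.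
- by apply: measurable_lne_comp; exact: measurable_comp_cell.
- by apply/measurable_EFinP; exact: (measurable_comp_cell mT (fun k => ln (v k))).
- by apply: filterS vpos => x vx _; rewrite lne_EFin.
Qed.

End divergences_of_cells.

(** * Divergences decrease under discretisation *)

Section data_processing.
Context (disp : measure_display) (X : measurableType disp) (R : realType).
Context (I : finType) (T : X -> I).
Hypothesis mT : forall k, measurable (T @^-1` [set k]).
Implicit Types (P Q : probability X R).
Local Notation mass := (cell_mass T).

Lemma ae_cell_mass_gt0 Q : {ae Q, forall x, 0 < mass Q (T x)}.
Proof.
pose g k : R := (mass Q k == 0)%:R.
have mA : measurable ((g \o T) @^-1` [set 1]).
  by rewrite -[X in measurable X]setTI; apply: measurable_comp_cell.
exists ((g \o T) @^-1` [set 1]); split => //.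
  rewrite -[X in Q X]setIT -integral_indic//.
  transitivity (\int[Q]_x (g (T x))%:E)%E.
    apply: eq_integral => x _; congr (_%:E); rewrite indicE /g.
    case: eqP => [Q0|/eqP Q0]; first by rewrite mem_set//= /g Q0 eqxx.
    rewrite memNset//= /g (negbTE Q0) => /eqP.
    by rewrite eq_sym oner_eq0.
  rewrite integral_comp_cellT// big1// => k _; rewrite /g.
  by case: eqP => [->|_]; rewrite ?mulr0 ?mul0r.
move=> x /= /negP; rewrite -leNgt => h; rewrite /g.
by rewrite (_ : mass Q (T x) == 0)//= eq_le h cell_mass_ge0.
Qed.

(** With [s] the ratio of the masses of the cell of [x] and [F] the density,
    [ln (F x) >= ln s + 1 - s / F x], and the integral of [s / F] under [Q] is at
    most the total mass of [Q]. *)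
Lemma cell_entropy_le P Q : Q `<< P ->
  ((vec_entropy (mass Q) (mass P))%:E <= relative_entropy Q P)%E.
Proof.
move=> QP; have [F [F0 mF FE _ densF]] := density_real QP.
rewrite (entropy_density QP mF densF).
pose s k := mass Q k / mass P k.
have s0 k : 0 <= s k by rewrite divr_ge0// cell_mass_ge0.
have sP k : s k * mass P k = mass Q k.
  have [Pk|Pk] := eqVneq (mass P k) 0; last by rewrite divfK.
  by rewrite Pk mulr0 (cell_mass_dominates mT QP).
have ms g : measurable_fun setT (fun x => g (T x) : R) by exact: measurable_comp_cell.
have mVF : measurable_fun setT (fun x => (F x)^-1).
  rewrite (_ : (fun x => _) = (fun x => F x `^ (- 1))).
    by apply: (measurableT_comp (measurable_powR _)).
  by apply/funext => x; rewrite powR_inv1.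
have QF : {ae Q, forall x, 0 < F x}.
  have mA : measurable (F @^-1` [set 0]).
    by rewrite -[X in measurable X]setTI; apply: mF.
  exists (F @^-1` [set 0]); split => //.
    rewrite -[X in Q X]setIT -integral_indic// -FE//.
    apply: integral0_eq => x _; rewrite indicE.
    by have [->|F0x] := eqVneq (F x) 0; rewrite ?mulr0// memNset ?mul0r//=; apply/eqP.
  by move=> x /= /negP; rewrite -leNgt => h; apply/eqP; rewrite eq_le h F0.
pose N x := s (T x) / F x.
have N0 x : 0 <= N x by rewrite divr_ge0.
have mN : measurable_fun setT N by exact: measurable_funM.
have intN : (\int[Q]_x (N x)%:E <= 1)%E.
  rewrite -FE//; apply: (@le_trans _ _ (\int[P]_x (s (T x))%:E)%E).
    apply: ge0_le_integral => //.
    - by move=> x _; rewrite lee_fin mulr_ge0.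
    - by apply/measurable_EFinP; exact: measurable_funM.
    - exact/measurable_EFinP.
    - move=> x _; rewrite lee_fin /N.
      have [->|Fx] := eqVneq (F x) 0; first by rewrite mulr0.
      by rewrite divfK.
  rewrite integral_comp_cellT// lee_fin (eq_bigr _ (fun k _ => sP k)).
  by have [_ ->] := prob_vec_cell_mass mT Q.
have iN : Q.-integrable setT (EFin \o N).
  apply/integrableP; split; first exact/measurable_EFinP.
  under eq_integral do rewrite /= ger0_norm//.
  by apply: le_lt_trans intN _; rewrite ltry.
pose f k := ln (s k) + 1.
have iF : Q.-integrable setT (EFin \o (f \o T)).
  apply/integrableP; split; first exact/measurable_EFinP/(ms f).
  rewrite /= (integral_comp_cellT mT Q (fun k => `|f k|)).
  by rewrite ltry.
apply: (@le_trans _ _ (\int[Q]_x ((f (T x))%:E - (N x)%:E))%E).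
  rewrite (integralB measurableT iF iN) (integral_comp_cellT mT Q f).
  have := intN; have : (0 <= \int[Q]_x (N x)%:E)%E.
    by apply: integral_ge0 => x _; rewrite lee_fin.
  rewrite /=; case: (\int[Q]_x (N x)%:E)%E => [n| |]//; rewrite !lee_fin => _ n1.
  rewrite /f; under eq_bigr do rewrite mulrDl mul1r.
  rewrite big_split/=; have [_ ->] := prob_vec_cell_mass mT Q.
  have -> : \sum_i ln (s i) * mass Q i = vec_entropy (mass Q) (mass P).
    by apply: eq_bigr => k _; rewrite mulrC.
  by lra.
apply: ae_le_integral.
- apply: emeasurable_funB; [exact/measurable_EFinP/(ms f)|exact/measurable_EFinP].
- exact: measurable_lne_comp.
- apply: filterS2 QF (ae_cell_mass_gt0 Q) => x Fx Qx.
  rewrite lne_EFin// -EFinB lee_fin /f /N.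
  have sx : 0 < s (T x).
    by rewrite lt_neqAle s0 andbT eq_sym; apply: contraTneq Qx; rewrite -sP => ->; rewrite mul0r ltxx.
  have := @ln_le_subr1 R (s (T x) / F x); rewrite divr_gt0// => /(_ isT).
  rewrite ln_div ?posrE//; lra.
Qed.

(** With [t] the ratio of the masses of the cell of [x] and [F] the density, integrate
    [(F x - t)^2 >= 0].  The terms are arranged so that all
    the integrands are nonnegative. *)
Lemma cell_chi2_le P Q (M : R) : (chi2 Q P <= M%:E)%E ->
  abs_cont (mass Q) (mass P) /\ vec_chi2 (mass Q) (mass P) <= M.
Proof.
rewrite /chi2; case: asboolP => [QP|_]; last by rewrite leye_eq.
have ac := cell_mass_dominates mT QP.
have [F [F0 mF FE densF _]] := density_real QP.
have -> : (\int[P]_x (density Q P x - 1) ^+ 2 = \int[P]_x ((F x - 1) ^+ 2)%:E)%E.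
  apply: ae_eq_integral => //.
  - under eq_fun do rewrite expe2.
    have mB : measurable_fun setT (fun x => density Q P x - 1)%E.
      by apply: emeasurable_funB => //; exact: measurable_density.
    exact: emeasurable_funM.
  - by apply/measurable_EFinP; apply: measurable_funX; exact: measurable_funB.
  - by apply: filterS densF => x /= h /h ->; rewrite /= expr2.
move=> FM; split=> //.
pose t k := mass Q k / mass P k.
have t0 k : 0 <= t k by rewrite divr_ge0// cell_mass_ge0.
have tP k : t k * mass P k = mass Q k.
  have [Pk|Pk] := eqVneq (mass P k) 0; last by rewrite divfK.
  by rewrite Pk mulr0 ac.
have mt g : measurable_fun setT (fun x => g (T x) : R) by exact: measurable_comp_cell.
have tF0 x : 0 <= 2 * t (T x) * F x by rewrite mulr_ge0// mulr_ge0.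
have h1 : (\int[P]_x ((2 * t (T x) * F x)%:E + 1%:E) <=
    \int[P]_x (((F x - 1) ^+ 2)%:E + (2 * F x)%:E + (t (T x) ^+ 2)%:E))%E.
  apply: ge0_le_integral => //.
  - by move=> x _; apply: adde_ge0; rewrite lee_fin// tF0.
  - apply: emeasurable_funD => //; apply/measurable_EFinP.
    by apply: measurable_funM => //; exact: (mt (fun k => 2 * t k)).
  - apply: emeasurable_funD; first apply: emeasurable_funD.
    + by apply/measurable_EFinP; apply: measurable_funX; exact: measurable_funB.
    + by apply/measurable_EFinP; exact: measurable_funM.
    + by apply/measurable_EFinP; exact: (mt (fun k => t k ^+ 2)).
  - move=> x _; rewrite -!EFinD lee_fin -subr_ge0.
    by rewrite (_ : _ - _ = (F x - t (T x)) ^+ 2) ?sqr_ge0//; ring.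
move: h1; rewrite ge0_integralD//; last 2 first.
- by move=> x _; rewrite lee_fin tF0.
- apply/measurable_EFinP.
  by apply: measurable_funM => //; exact: (mt (fun k => 2 * t k)).
rewrite ge0_integralD//; last 4 first.
- by move=> x _; rewrite -EFinD lee_fin addr_ge0 ?sqr_ge0// mulr_ge0.
- apply: emeasurable_funD; apply/measurable_EFinP; last exact: measurable_funM.
  by apply: measurable_funX; exact: measurable_funB.
- by move=> x _; rewrite lee_fin sqr_ge0.
- by apply/measurable_EFinP; exact: (mt (fun k => t k ^+ 2)).
rewrite ge0_integralD//; last 4 first.
- by move=> x _; rewrite lee_fin sqr_ge0.
- by apply/measurable_EFinP; apply: measurable_funX; exact: measurable_funB.
- by move=> x _; rewrite lee_fin mulr_ge0.
- by apply/measurable_EFinP; exact: measurable_funM.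
rewrite (FE (fun x => 2 * t (T x))); last 2 first.
- by move=> x; rewrite mulr_ge0.
- exact: (mt (fun k => 2 * t k)).
rewrite (FE (fun=> 2))//.
rewrite (integral_comp_cellT mT Q (fun k => 2 * t k)).
rewrite (integral_comp_cellT mT P (fun k => t k ^+ 2)).
have -> : (\int[P]__ 1 = 1)%E.
  by rewrite integral_cst// mul1e; exact: probability_setT.
have -> : (\int[Q]__ 2%:E = 2%:E)%E.
  by rewrite integral_cst// [X in (_ * X)%E](probability_setT Q) mule1.
move: FM; have : (0 <= \int[P]_x ((F x - 1) ^+ 2)%:E)%E.
  by apply: integral_ge0 => x _; rewrite lee_fin sqr_ge0.
case: (\int[P]_x _)%E => [n| |]//; rewrite -!EFinD !lee_fin => _ nM.
have -> : \sum_k 2 * t k * mass Q k = 2 * \sum_k t k * mass Q k.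
  by rewrite mulr_sumr; apply: eq_bigr => k _; rewrite mulrA.
have -> : \sum_k t k ^+ 2 * mass P k = \sum_k t k * mass Q k.
  by apply: eq_bigr => k _; rewrite expr2 -mulrA tP.
have -> : vec_chi2 (mass Q) (mass P) = \sum_k (t k * mass Q k - 2 * mass Q k + mass P k).
  apply: eq_bigr => k _; rewrite /t.
  have [Pk|Pk] := eqVneq (mass P k) 0; last by field.
  by rewrite Pk (ac k Pk) invr0 !mulr0 subr0 addr0.
rewrite big_split sumrB/= -mulr_sumr.
have [_ ->] := prob_vec_cell_mass mT Q; have [_ ->] := prob_vec_cell_mass mT P.
lra.
Qed.

End data_processing.

(** * Plans and couplings *)

Section couplings_of_cells.
Context (R : realType) (d : nat) (I : finType).
Local Notation X := (Rd R d).
Context (T : X -> I).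
Hypothesis mT : forall k, measurable (T @^-1` [set k]).
Implicit Types (P Q : probability X R) (pi : probability (X * X)%type R)
  (w a : I -> I -> R).
Local Notation mass := (cell_mass T).

Definition cell_pair (z : X * X) : I * I := (T z.1, T z.2).

Lemma cell_pair_preimage (kl : I * I) :
  cell_pair @^-1` [set kl] = T @^-1` [set kl.1] `*` T @^-1` [set kl.2].
Proof.
apply/seteqP; split => -[x y] /=; first by move=> <-.
by case: kl => k l /= [] <- <-.
Qed.

Lemma measurable_cell_pair (kl : I * I) : measurable (cell_pair @^-1` [set kl]).
Proof. by rewrite cell_pair_preimage; exact: measurableX. Qed.

Definition cell_plan pi (k l : I) : R := cell_mass cell_pair pi (k, l).

Lemma cell_plan_coupling P Q pi : coupling P Q pi ->
  plan (mass P) (mass Q) (cell_plan pi).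
Proof.
move=> [piP piQ]; split=> [k l|k|l]; first exact: cell_mass_ge0.
- apply: EFin_inj; rewrite -cell_massE//.
  rewrite -piP// -sumEFin.
  have m2 l : measurable ((T \o snd) @^-1` [set l] : set (X * X)).
    rewrite (_ : _ @^-1` _ = setT `*` T @^-1` [set l]); first exact: measurableX.
    by apply/seteqP; split => -[x y] //= [].
  rewrite -(sum_measure_cells m2 pi) ; last exact: measurableX.
  apply: eq_bigr => l _; rewrite -cell_massE; last exact: measurable_cell_pair.
  congr (pi _); rewrite cell_pair_preimage.
  by apply/seteqP; split => -[x y] /= [] => [-> ->|[-> _] ->].
- apply: EFin_inj; rewrite -cell_massE//.
  rewrite -piQ// -sumEFin.
  have m1 k : measurable ((T \o fst) @^-1` [set k] : set (X * X)).
    rewrite (_ : _ @^-1` _ = T @^-1` [set k] `*` setT); first exact: measurableX.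
    by apply/seteqP; split => -[x y] //= [].
  rewrite -(sum_measure_cells m1 pi) ; last exact: measurableX.
  apply: eq_bigr => k _; rewrite -cell_massE; last exact: measurable_cell_pair.
  congr (pi _); rewrite cell_pair_preimage.
  by apply/seteqP; split => -[x y] /= [] => [-> ->|[_ ->] ->].
Qed.

Lemma integral_cell_plan pi a :
  (\int[pi]_z (a (T z.1) (T z.2))%:E = (plan_cost a (cell_plan pi))%:E)%E.
Proof.
rewrite (integral_comp_cellT measurable_cell_pair pi (fun kl => a kl.1 kl.2)).
by rewrite /plan_cost pair_bigA; congr (_%:E); apply: eq_bigr => -[k l].
Qed.

(** Within each pair of cells the coupling is the product of the restrictions of
    [P] and [Q], scaled to the mass prescribed by the plan. *)
Lemma plan_lift P Q w : plan (mass P) (mass Q) w ->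
  exists2 pi, coupling P Q pi & forall k l, cell_plan pi k l = w k l.
Proof.
move=> pw; have [w0 wP wQ] := pw.
pose v (kl : I * I) := w kl.1 kl.2 / (mass P kl.1 * mass Q kl.2).
have v0 kl : 0 <= v kl by rewrite divr_ge0// mulr_ge0// cell_mass_ge0.
have vw k l : v (k, l) * mass P k * mass Q l = w k l.
  rewrite /v /=; have [Pk|Pk] := eqVneq (mass P k) 0.
    by rewrite (plan_eq0l l pw Pk) !mul0r.
  have [Ql|Ql] := eqVneq (mass Q l) 0.
    by rewrite (plan_eq0r k pw Ql) !mul0r.
  by field; rewrite Pk Ql.
have massX kl : cell_mass cell_pair (P \x Q)%E kl = mass P kl.1 * mass Q kl.2.
  apply: EFin_inj; rewrite -cell_massE; last exact: measurable_cell_pair.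
  rewrite cell_pair_preimage; apply: etrans (product_measure1E _ _ _ _) _ => //.
  by rewrite EFinM; congr (_ * _)%E; exact: cell_massE.
have [|pi piE piv] := @reweighting_exists _ _ _ _ _ measurable_cell_pair (P \x Q)%E v v0.
  under eq_bigr do rewrite massX mulrA.
  rewrite -(pair_bigA _ (fun k l => v (k, l) * mass P k * mass Q l))/=.
  under eq_bigr do under eq_bigr do rewrite vw.
  under eq_bigr do rewrite wP.
  by have [_ ->] := prob_vec_cell_mass mT P.
have piX A B : measurable A -> measurable B -> pi (A `*` B) =
    (\sum_k \sum_l (v (k, l))%:E * (P (A `&` T @^-1` [set k]) *
       Q (B `&` T @^-1` [set l])))%E.
  move=> mA mB; rewrite piE; last exact: measurableX.
  rewrite (integral_comp_cell measurable_cell_pair); last exact: measurableX.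
  rewrite [RHS](pair_bigA _ (fun k l => (v (k, l))%:E * (P (A `&` T @^-1` [set k]) *
       Q (B `&` T @^-1` [set l])))%E)/=; apply: eq_bigr => -[k l] _.
  rewrite cell_pair_preimage/= -setXI; congr (_ * _)%E.
  by apply: product_measure1E; exact: measurableI.
exists pi; last by move=> k l; rewrite /cell_plan piv massX mulrA vw.
split=> [A mA|B mB].
- rewrite piX// -(sum_measure_cells mT P mA); apply: eq_bigr => k _.
  have [Pk|Pk] := eqVneq (mass P k) 0.
    have -> : P (A `&` T @^-1` [set k]) = 0%E.
      apply: (subset_measure0 _ (mT k)) => //; first exact: measurableI.
      by apply: etrans (cell_massE mT P k) _; rewrite Pk.
    by rewrite big1// => l _; rewrite mul0e mule0.
  have /fineK <- : P (A `&` T @^-1` [set k]) \is a fin_num.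
    by apply: fin_num_measure; exact: measurableI.
  under eq_bigr do rewrite setTI cell_massE// -!EFinM.
  rewrite sumEFin; congr (_%:E); set x := fine _.
  transitivity (\sum_l w k l * (x / mass P k)).
    by apply: eq_bigr => l _; rewrite -vw; field.
  by rewrite -mulr_suml wP mulrC divfK.
- rewrite piX// exchange_big/= -(sum_measure_cells mT Q mB); apply: eq_bigr => l _.
  have [Ql|Ql] := eqVneq (mass Q l) 0.
    have -> : Q (B `&` T @^-1` [set l]) = 0%E.
      apply: (subset_measure0 _ (mT l)) => //; first exact: measurableI.
      by apply: etrans (cell_massE mT Q l) _; rewrite Ql.
    by rewrite big1// => k _; rewrite !mule0.
  have /fineK <- : Q (B `&` T @^-1` [set l]) \is a fin_num.
    by apply: fin_num_measure; exact: measurableI.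
  under eq_bigr do rewrite setTI cell_massE// -!EFinM.
  rewrite sumEFin; congr (_%:E); set x := fine _.
  transitivity (\sum_k w k l * (x / mass Q l)).
    by apply: eq_bigr => k _; rewrite -vw; field.
  by rewrite -mulr_suml wQ mulrC divfK.
Qed.

Lemma integral_coupling_fst P Q pi (h : X -> \bar R) : coupling P Q pi ->
  measurable_fun setT h -> (forall x, 0 <= h x)%E ->
  (\int[pi]_z h z.1 = \int[P]_x h x)%E.
Proof.
move=> [piP _] mh h0.
have := @ge0_integral_pushforward _ _ _ _ R fst measurable_fst pi setT h
  measurableT mh (fun x _ => h0 x).
rewrite preimage_setT => <-; apply/esym/eq_measure_integral => A mA _.
by apply: etrans (esym (piP A mA)) _; congr (pi _); apply/seteqP; split => -[x y] //= [].
Qed.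

Lemma integral_coupling_snd P Q pi (h : X -> \bar R) : coupling P Q pi ->
  measurable_fun setT h -> (forall x, 0 <= h x)%E ->
  (\int[pi]_z h z.2 = \int[Q]_x h x)%E.
Proof.
move=> [_ piQ] mh h0.
have := @ge0_integral_pushforward _ _ _ _ R snd measurable_snd pi setT h
  measurableT mh (fun x _ => h0 x).
rewrite preimage_setT => <-; apply/esym/eq_measure_integral => A mA _.
by apply: etrans (esym (piQ A mA)) _; congr (pi _); apply/seteqP; split => -[x y] //= [].
Qed.

End couplings_of_cells.

(** * Mixtures of infinitely many vectors *)

Section infinite_mixture.
Context (dT : measure_display) (Theta : measurableType dT) (R : realType).
Context (m : probability Theta R) (I : finType).
Context (p : Theta -> I -> R) (pbar : I -> R).
Hypotheses (p_prob : forall t, prob_vec (p t))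
  (p_meas : forall k, measurable_fun setT (fun t => p t k))
  (p_ac : forall t t', abs_cont (p t) (p t'))
  (pbarE : forall k, (\int[m]_t (p t k)%:E = (pbar k)%:E)%E).

Let p_ge0 t k : 0 <= p t k. Proof. by have [->] := p_prob t. Qed.

Let p_le1 t k : p t k <= 1.
Proof.
have [p0 <-] := p_prob t.
by rewrite (bigD1 k)//= lerDl sumr_ge0.
Qed.

Lemma pbar_ge0 k : 0 <= pbar k.
Proof. by rewrite -lee_fin -pbarE; apply: integral_ge0 => t _; rewrite lee_fin. Qed.

(** The [p t] all vanish at the same indices, so a zero of the mean is a zero of
    each of them. *)
Lemma pbar_eq0 k : pbar k = 0 -> forall t, p t k = 0.
Proof.
move=> k0; suff [t pt0] : exists t, p t k = 0 by move=> t'; exact: p_ac pt0.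
have mp : measurable_fun setT (fun t => (p t k)%:E) by exact/measurable_EFinP.
have : (\int[m]_t `|(p t k)%:E| = 0)%E.
  rewrite -[RHS](congr1 EFin k0) -pbarE; apply: eq_integral => t _.
  by rewrite gee0_abs// lee_fin.
move=> /(ae_eq_integral_abs m measurableT mp)[N [mN N0 sub]].
apply: contrapT => h.
have : m setT = 0%E.
  apply: (subset_measure0 _ mN) => // t _; apply: sub => /= /(_ Logic.I) [] pt.
  by apply: h; exists t.
by rewrite probability_setT => -[] /eqP; rewrite oner_eq0.
Qed.

Let bins (N : nat) : finType := {ffun I -> 'I_N.+1}.

Let bin (N : nat) t : bins N :=
  [ffun k => inord (Num.truncn (N%:R * p t k))].

Let bin_size N t k : (Num.truncn (N%:R * p t k) < N.+1)%N.
Proof. by rewrite ltnS -{2}(@natrK R N); apply: le_truncn; rewrite ler_piMr. Qed.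

Let bin_close N t t' k : (0 < N)%N -> bin N t = bin N t' ->
  p t k <= p t' k + N%:R^-1.
Proof.
move=> N0 /ffunP/(_ k); rewrite !ffunE => /(congr1 val); rewrite /= !inordK// => e.
have N0R : 0 < N%:R :> R by rewrite ltr0n.
have /andP[_ h] := @truncn_itv R (N%:R * p t k) (mulr_ge0 (ler0n _ _) (p_ge0 t k)).
have /andP[h' _] := @truncn_itv R (N%:R * p t' k) (mulr_ge0 (ler0n _ _) (p_ge0 t' k)).
rewrite -(ler_pM2l N0R) mulrDr mulfV ?gt_eqF//.
apply: le_trans (ltW h) _; rewrite -natr1 lerD2r e; exact: h'.
Qed.

Let measurable_bin N (j : bins N) : measurable (bin N @^-1` [set j]).
Proof.
rewrite (_ : _ @^-1` _ = \bigcap_(k in [set: I])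
    [set t | Num.truncn (N%:R * p t k) = j k :> nat]).
  apply: fin_bigcap_measurable => // k _.
  have mg : measurable_fun setT (fun t => (Num.truncn (N%:R * p t k))%:R : R).
    apply: (@measurableT_comp _ _ _ _ _ _ (fun x : R => (Num.truncn (N%:R * x))%:R : R)) (p_meas k).
    apply: nondecreasing_measurable => // x y xy.
    by rewrite ler_nat; apply: le_truncn; rewrite ler_wpM2l.
  have := mg measurableT [set (j k)%:R] (measurable_set1 _).
  rewrite setTI; congr measurable; apply/seteqP; split => x /=.
    by move/eqP; rewrite eqr_nat => /eqP.
  by move=> ->.
apply/seteqP; split => [x /= <- k _|x /= h]; first by rewrite /= ffunE inordK.
by apply/ffunP => k; apply: val_inj; rewrite /= ffunE inordK// h.
Qed.

(** [Theta] is cut into finitely many pieces on which [p] varies by less than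
    [N^-1], and one parameter is chosen in each.  The error is relative to
    [pbar k] because the finitely many positive values of [pbar] are bounded below
    by a positive constant. *)
Lemma finite_mixture_approx (e : R) : 0 < e ->
  exists (J : finType) (w : J -> R) (t : J -> Theta), prob_vec w /\
    forall k, (1 - e) * pbar k <= vec_mixture w (p \o t) k <= (1 + e) * pbar k.
Proof.
move=> e0; have [t0 _] := probability_inhabited m.
pose b : R := \big[Num.min/1]_(k | 0 < pbar k) pbar k.
have b0 : 0 < b by apply: lt_bigmin.
have [N N0 NV] : exists2 N, (0 < N)%N & N%:R^-1 <= e * b.
  have eb0 : 0 < e * b by exact: mulr_gt0.
  exists (Num.truncn (e * b)^-1).+1 => //.
  have := truncnS_gt (e * b)^-1; move: (_.+1) => N eb.
  by rewrite invf_ple ?posrE ?(lt_trans _ eb) ?invr_gt0//; exact: ltW.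
pose rep (j : bins N) := xget t0 (bin N @^-1` [set j]).
have repE t : bin N (rep (bin N t)) = bin N t.
  have t_bin : exists t', (bin N @^-1` [set bin N t]) t' by exists t.
  exact: (xgetPex t0 t_bin).
exists (bins N), (cell_mass (bin N) m), rep.
split; first by apply: prob_vec_cell_mass; exact: measurable_bin.
move=> k.
have mixE : (\int[m]_t (p (rep (bin N t)) k)%:E =
    (vec_mixture (cell_mass (bin N) m) (p \o rep) k)%:E)%E.
  rewrite (integral_comp_cellT (@measurable_bin N) m (fun j => p (rep j) k)).
  by congr (_%:E); apply: eq_bigr => j _; rewrite mulrC.
have mrep : measurable_fun setT (fun t => (p (rep (bin N t)) k)%:E).
  apply/measurable_EFinP.
  exact: (measurable_comp_cell (@measurable_bin N) (fun j => p (rep j) k)).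
have mp : measurable_fun setT (fun t => (p t k)%:E) by exact/measurable_EFinP.
set P' := vec_mixture _ _ k in mixE *.
have bound (f g : Theta -> R) : (forall t, 0 <= f t) -> (forall t, 0 <= g t) ->
    measurable_fun setT (EFin \o f) -> measurable_fun setT (EFin \o g) ->
    (forall t, f t <= g t + N%:R^-1) ->
    (\int[m]_t (f t)%:E <= \int[m]_t (g t)%:E + (N%:R^-1)%:E)%E.
  move=> f0 g0 mf mg fg.
  apply: (@le_trans _ _ (\int[m]_t ((g t)%:E + (N%:R^-1)%:E))%E).
    apply: ge0_le_integral => //.
    - by move=> t _; rewrite lee_fin.
    - exact: emeasurable_funD.
    - by move=> t _; rewrite -EFinD lee_fin.
  rewrite ge0_integralD//; last by move=> t _; rewrite lee_fin.
  by rewrite integral_cst// [X in (_ * X)%E](probability_setT m) mule1.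
have up : P' <= pbar k + N%:R^-1.
  rewrite -lee_fin EFinD -mixE -pbarE; apply: bound => // t.
  exact: bin_close.
have lo : pbar k <= P' + N%:R^-1.
  rewrite -lee_fin EFinD -mixE -pbarE; apply: bound => // t.
  by apply: bin_close => //; rewrite repE.
have [k0|k0] := eqVneq (pbar k) 0.
  have -> : P' = 0 by apply: big1 => j _; rewrite /= (pbar_eq0 k0) mulr0.
  by rewrite k0 !mulr0 lexx.
have kgt : 0 < pbar k by rewrite lt_neqAle eq_sym k0 pbar_ge0.
have bk : b <= pbar k by exact: bigmin_le_cond.
have ek : N%:R^-1 <= e * pbar k by apply: le_trans NV _; rewrite ler_pM2l.
by apply/andP; split; lra.
Qed.

(** Both sides of [finite_mixture_transport] are stable under the relative error
    of [finite_mixture_approx].  Only [p] is approximated: [q] stays fixed. *)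
Lemma infinite_mixture_transport (a : I -> I -> R) (A C M e : R) :
  (forall i k l, a i l <= 2 * (a i k + a k l)) ->
  (forall i j, 0 <= a i j <= A) -> 0 <= A -> 0 <= C -> prob_vec pbar ->
  (forall t t', vec_chi2 (p t) (p t') <= M) ->
  (forall t r, prob_vec r -> abs_cont r (p t) ->
    transportable a (p t) r (C * vec_entropy r (p t) + e)) ->
  forall q, prob_vec q -> abs_cont q pbar -> forall delta : R, 0 < delta ->
  transportable a pbar q
    (2 * Num.max 1 (2 * M) * C * vec_entropy q pbar + 4 * e + delta).
Proof.
move=> tri aA A0 C0 pbar_prob chiM pT q q_prob q_ac delta delta0.
set K : R := 2 * Num.max 1 (2 * M) * C.
have K0 : 0 <= K by rewrite !mulr_ge0// le_max ler01.
pose h := Num.min (1 / 2) (delta / (2 * K + A + 1)).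
have D0 : 0 < 2 * K + A + 1 by lra.
have h0 : 0 < h by rewrite lt_min; apply/andP; split; [lra|exact: divr_gt0].
have h12 : h <= 1 / 2 by rewrite ge_min lexx.
have hd : h * (2 * K + A + 1) <= delta.
  by rewrite -ler_pdivlMr// ge_min lexx orbT.
have [J [w [t [w_prob wt]]]] := finite_mixture_approx h0.
have pt_prob j : prob_vec ((p \o t) j) by exact: p_prob.
have q_ac' : abs_cont q (vec_mixture w (p \o t)).
  move=> k k0; apply: q_ac; apply/eqP; rewrite eq_le pbar_ge0 andbT.
  have /andP[+ _] := wt k; rewrite k0 pmulr_rle0//; lra.
have := @finite_mixture_transport _ _ _ w (p \o t) w_prob pt_prob a C M e tri C0
  (fun j j' => @p_ac (t j) (t j')) (fun j j' => chiM (t j) (t j'))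
  (fun j => @pT (t j)) q q_prob q_ac'.
move=> /(transport_perturb aA A0 h0 pbar_prob
  (prob_vec_mixture w_prob pt_prob) q_prob (fun k => proj2 (andP (wt k)))) T1.
apply: transportable_le T1; rewrite -/K.
have ent : vec_entropy q (vec_mixture w (p \o t)) <= vec_entropy q pbar - ln (1 - h).
  apply: vec_entropy_perturb => //; first lra.
  - exact: pbar_ge0.
  - by move=> k; have /andP[] := wt k.
have ln_h : - ln (1 - h) <= 2 * h.
  have h'0 : 0 < 1 - h by lra.
  have := @ln_le_subr1 R (1 - h)^-1; rewrite invr_gt0 => /(_ h'0).
  rewrite lnV ?posrE// => /le_trans; apply.
  have -> : (1 - h)^-1 - 1 = h / (1 - h) by field; rewrite gt_eqF.
  by rewrite ler_pdivrMr//; nra.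
have := ler_wpM2l K0 (le_trans ent (lerD (lexx _) ln_h)).
lra.
Qed.

End infinite_mixture.

(** * The cost of rounding *)

Section cost_on_the_grid.
Context (R : realType) (d : nat) (alpha : R -> R).
Hypothesis alphaP : quadratic_like alpha.
Local Notation X := (Rd R d).
Local Notation c := (@sum_cost R d alpha).
Implicit Types (n : nat) (x y : 'rV[R]_d).

Definition mesh_cost n : R := d%:R * alpha n.+1%:R^-1.

Definition round n x : 'rV[R]_d := cell_point R (cell n x).

Let clampv n x : 'rV[R]_d := \row_i clamp n.+1%:R (x ord0 i).

Let sub_coord (u v : 'rV[R]_d) i : (u - v) ord0 i = u ord0 i - v ord0 i.
Proof. by rewrite !mxE. Qed.

Let round_clamp n x i :
  0 <= clampv n x ord0 i - round n x ord0 i <= n.+1%:R^-1.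
Proof. by rewrite mxE cell_pointE; exact: grid_round_itv. Qed.

Let cost_clampv n x : c (clampv n x) <= c x.
Proof. by apply: (sum_cost_le alphaP) => i; rewrite mxE; exact: clamp_norm. Qed.

Lemma mesh_cost_ge0 n : 0 <= mesh_cost n.
Proof. by rewrite mulr_ge0// ql_ge0. Qed.

Lemma mesh_cost_le n : mesh_cost n <= d%:R * alpha 1.
Proof.
rewrite ler_wpM2l//; apply: (ql_le alphaP).
by rewrite normr1 ger0_norm ?invr_ge0// invf_le1 ?ltr0n// ler1n.
Qed.

Lemma mesh_cost_cvg : mesh_cost n @[n --> \oo] --> (0 : R).
Proof.
suff : mesh_cost n @[n --> \oo] --> d%:R * alpha 0 by rewrite (ql_0 alphaP) mulr0.
apply: cvgMr; apply: continuous_cvg; first exact: ql_continuous.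
exact: cvg_harmonic.
Qed.

Let cost_clamp_round n x : c (clampv n x - round n x) <= mesh_cost n.
Proof.
apply: sum_cost_bounded => // i; have /andP[h0 h1] := round_clamp n x i.
by rewrite sub_coord !ger0_norm// invr_ge0.
Qed.

(** Clamping contracts every coordinate, and truncation moves the difference of
    two coordinates by at most the mesh. *)
Lemma cost_round_contract n x y :
  c (round n x - round n y) <= 6 / 5 * c (x - y) + 6 * mesh_cost n.
Proof.
have -> : round n x - round n y = (clampv n x - clampv n y) +
    ((clampv n y - round n y) - (clampv n x - round n x)).
  by apply/rowP => i; rewrite !mxE; ring.
apply: le_trans (sum_cost_add_sixth alphaP _ _) _; apply: lerD.
  rewrite ler_wpM2l ?divr_ge0//.
  by apply: (sum_cost_le alphaP) => i; rewrite !mxE; exact: clamp_contract.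
rewrite ler_wpM2l//; apply: sum_cost_bounded => // i.
have /andP[hx0 hx1] := round_clamp n x i; have /andP[hy0 hy1] := round_clamp n y i.
rewrite !sub_coord [leRHS]ger0_norm ?invr_ge0//.
move: (n.+1%:R^-1) hx1 hy1 => e hx1 hy1.
by rewrite ler_norml; apply/andP; split; lra.
Qed.

Lemma cost_round n x : c (round n x) <= 2 * c x + 2 * mesh_cost n.
Proof.
rewrite -[round n x](subrK (clampv n x)) addrC -mulrDr.
apply: le_trans (sum_cost_add2 alphaP _ _) _; rewrite ler_wpM2l//; apply: lerD => //.
by rewrite -opprB (sum_cost_opp alphaP).
Qed.

(** Provides the dominating function for the convergence of the cost of rounding
    to zero. *)
Lemma cost_round_defect n x : c (x - round n x) <= 2 * c x + 2 * mesh_cost n.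
Proof.
have -> : x - round n x = (x - clampv n x) + (clampv n x - round n x).
  by rewrite addrA subrK.
rewrite -mulrDr; apply: le_trans (sum_cost_add2 alphaP _ _) _; rewrite ler_wpM2l//; apply: lerD => //.
by apply: (sum_cost_le alphaP) => i; rewrite !mxE; exact: clamp_defect.
Qed.

Let round_cvg x i : round n x ord0 i @[n --> \oo] --> x ord0 i.
Proof.
by under eq_fun do rewrite cell_pointE; exact: grid_round_cvg.
Qed.

Lemma cost_round_cvg x : c (round n x) @[n --> \oo] --> c x.
Proof. by apply: (sum_cost_cvg alphaP) => i; exact: round_cvg. Qed.

Lemma cost_round_defect_cvg x : c (x - round n x) @[n --> \oo] --> (0 : R).
Proof.
have -> : 0 = c 0 :> R by apply/esym/big1 => i _; rewrite mxE (ql_0 alphaP).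
apply: (sum_cost_cvg alphaP) => i; rewrite mxE -(subrr (x ord0 i)).
under eq_fun do rewrite sub_coord.
by apply: cvgB; [exact: cvg_cst|exact: round_cvg].
Qed.

Lemma measurable_cost : measurable_fun setT (c : X -> R).
Proof. by apply: (measurable_sum_cost alphaP) => i; exact: measurable_coord. Qed.

Lemma measurable_cost_sub :
  measurable_fun setT (fun z : X * X => c ((z.1 : 'rV[R]_d) - z.2)).
Proof.
apply: (measurable_sum_cost alphaP) => i.
under eq_fun do rewrite sub_coord.
apply: measurable_funB.
- exact: (measurableT_comp (measurable_coord i) measurable_fst).
- exact: (measurableT_comp (measurable_coord i) measurable_snd).
Qed.

Lemma measurable_cost_round n : measurable_fun setT (fun x : X => c (round n x)).
Proof.
exact: (measurable_comp_cell (@measurable_cell R d n) (fun k => c (cell_point R k))).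
Qed.

Lemma measurable_cost_round_defect n :
  measurable_fun setT (fun x : X => c ((x : 'rV[R]_d) - round n x)).
Proof.
apply: (measurable_sum_cost alphaP) => i.
under eq_fun do rewrite sub_coord.
apply: measurable_funB; first exact: measurable_coord.
exact: (measurable_comp_cell (@measurable_cell R d n)
  (fun k => cell_point R k ord0 i)).
Qed.

End cost_on_the_grid.

(** * The transport inequality on the grid *)

Section discretised_transport.
Context (R : realType) (d : nat) (alpha : R -> R).
Hypothesis alphaP : quadratic_like alpha.
Local Notation X := (Rd R d).
Local Notation c := (@sum_cost R d alpha).
Local Notation mass n := (@cell_mass _ (Rd R d) R (cells d n) (@cell R d n)).
Implicit Types (n : nat) (P Q : probability X R).

Definition grid_cost n (k l : cells d n) : R :=
  c (cell_point R k - cell_point R l).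

(** The first term bounds the cost of rounding; the second makes up for the
    infimum in [transport_cost], which need not be attained. *)
Definition grid_error n : R := 6 * mesh_cost d alpha n + n.+1%:R^-1.

Lemma grid_cost_triangle n (i k l : cells d n) :
  grid_cost i l <= 2 * (grid_cost i k + grid_cost k l).
Proof.
rewrite /grid_cost -[cell_point R i - _](subrKA (cell_point R k)).
exact: sum_cost_add2.
Qed.

Lemma grid_cost_bounded n (i j : cells d n) :
  0 <= grid_cost i j <= \sum_k \sum_l @grid_cost n k l.
Proof.
have a0 (k l : cells d n) : 0 <= grid_cost k l by exact: sum_cost_ge0.
rewrite a0/= (bigD1 i)//= (bigD1 j)//= -addrA lerDl addr_ge0//.
  by apply: sumr_ge0.
by apply: sumr_ge0 => k _; apply: sumr_ge0.
Qed.

Lemma grid_error_gt0 n : 0 < grid_error n.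
Proof. by rewrite ltr_wpDl ?invr_gt0// mulr_ge0// mesh_cost_ge0. Qed.

Lemma grid_error_le n : grid_error n <= 6 * (d%:R * alpha 1) + 1.
Proof.
apply: lerD; first by rewrite ler_wpM2l// mesh_cost_le.
by rewrite invf_le1 ?ltr0n// ler1n.
Qed.

Lemma grid_error_cvg : grid_error n @[n --> \oo] --> (0 : R).
Proof.
suff : grid_error n @[n --> \oo] --> (6 * 0 + 0 : R) by rewrite mulr0 addr0.
apply: cvgD; last exact: cvg_harmonic.
by apply: cvgMr; exact: mesh_cost_cvg.
Qed.

(** Integrability of the cost passes from one marginal of a plan of finite cost to
    the other. *)
Lemma grid_moment n (p q : cells d n -> R) (B : R) :
  transportable (@grid_cost n) p q B ->
  \sum_k p k * c (cell_point R k) <= 2 * B + 2 * \sum_l q l * c (cell_point R l)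
  /\ \sum_l q l * c (cell_point R l) <= 2 * B + 2 * \sum_k p k * c (cell_point R k).
Proof.
move=> [w [w0 wp wq] cw].
have pE : \sum_k p k * c (cell_point R k) =
    \sum_k \sum_l w k l * c (cell_point R k).
  by apply: eq_bigr => k _; rewrite -mulr_suml wp.
have qE : \sum_l q l * c (cell_point R l) =
    \sum_k \sum_l w k l * c (cell_point R l).
  by rewrite exchange_big/=; apply: eq_bigr => k _; rewrite -mulr_suml wq.
have step (f g : cells d n -> cells d n -> R) :
    (forall k l, f k l <= 2 * (grid_cost k l + g k l)) ->
    \sum_k \sum_l w k l * f k l <= 2 * B + 2 * \sum_k \sum_l w k l * g k l.
  move=> fg; apply: (@le_trans _ _ (2 * plan_cost (@grid_cost n) w +
      2 * \sum_k \sum_l w k l * g k l)); last by rewrite lerD2r ler_pM2l.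
  rewrite -mulrDr /plan_cost -big_split/= mulr_sumr; apply: ler_sum => k _.
  rewrite -big_split/= mulr_sumr; apply: ler_sum => l _.
  rewrite [grid_cost k l * _]mulrC -mulrDr mulrCA.
  by rewrite ler_wpM2l.
rewrite pE qE; split; apply: step => k l.
  by rewrite -{1}[cell_point R k](subrK (cell_point R l)); exact: sum_cost_add2.
rewrite -{1}[cell_point R l](subrK (cell_point R k)).
have -> : grid_cost k l = c (cell_point R l - cell_point R k).
  by rewrite /grid_cost -opprB (sum_cost_opp alphaP).
exact: sum_cost_add2.
Qed.

Lemma integral_cost_round n P :
  (\int[P]_x (c (round n x))%:E =
   (\sum_k mass n P k * c (cell_point R k))%:E)%E.
Proof.
rewrite (integral_comp_cellT (@measurable_cell R d n) P
  (fun k => c (cell_point R k))).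
by congr (_%:E); apply: eq_bigr => k _; rewrite mulrC.
Qed.

(** A vector [r] is lifted to a measure by [tilt_exists], and a nearly optimal
    coupling with that measure is pushed forward to the grid. *)
Lemma transport_inequality_on_grid P (C : R) : 0 <= C ->
  (forall Q, transport_cost c P Q <= C%:E * relative_entropy Q P)%E ->
  forall n (r : cells d n -> R), prob_vec r -> abs_cont r (mass n P) ->
  transportable (@grid_cost n) (mass n P) r
    (6 / 5 * C * vec_entropy r (mass n P) + grid_error n).
Proof.
move=> C0 PC n r r_prob r_ac.
have mT := @measurable_cell R d n.
have [Q Qr QD] := tilt_exists mT r_prob r_ac.
have := PC Q; rewrite QD -EFinM => TQ.
have /ereal_inf_lt[_ [pi piPQ <-] pi_lt] :
    (transport_cost c P Q <
     (C * vec_entropy r (mass n P) + 5 / 6 * n.+1%:R^-1)%:E)%E.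
  by apply: le_lt_trans TQ _; rewrite lte_fin ltrDl mulr_gt0 ?invr_gt0//; lra.
exists (cell_plan (@cell R d n) pi).
  have := cell_plan_coupling mT piPQ; congr plan.
  by apply/funext => k; rewrite Qr.
rewrite -lee_fin -(integral_cell_plan mT).
apply: (@le_trans _ _ (\int[pi]_z ((6 / 5)%:E * (c ((z.1 : 'rV[R]_d) - z.2))%:E +
    (6 * mesh_cost d alpha n)%:E))%E).
  apply: ge0_le_integral => //.
  - by move=> z _; rewrite lee_fin sum_cost_ge0.
  - apply/measurable_EFinP.
    exact: (measurable_comp_cell (measurable_cell_pair mT)
      (fun kl => grid_cost kl.1 kl.2)).
  - apply: emeasurable_funD => //; apply: measurable_funeM.
    by apply/measurable_EFinP; exact: measurable_cost_sub.
  - by move=> z _; rewrite -EFinM -EFinD lee_fin; exact: cost_round_contract.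
have mc : measurable_fun setT (fun z : X * X => (c ((z.1 : 'rV[R]_d) - z.2))%:E).
  by apply/measurable_EFinP; exact: measurable_cost_sub.
have c0 (z : X * X) : (0 <= (c ((z.1 : 'rV[R]_d) - z.2))%:E)%E.
  by rewrite lee_fin sum_cost_ge0.
rewrite ge0_integralD//; last 3 first.
- by move=> z _; rewrite mule_ge0// lee_fin divr_ge0.
- exact: measurable_funeM.
- by move=> z _; rewrite lee_fin mulr_ge0// mesh_cost_ge0.
rewrite ge0_integralZl//.
rewrite integral_cst// [X in (_ + _ * X)%E](probability_setT pi) mule1.
have : (0 <= \int[pi]_z (c ((z.1 : 'rV[R]_d) - z.2))%:E)%E by exact: integral_ge0.
move: pi_lt; case: (\int[pi]_z _)%E => [t| |]// ; rewrite lte_fin => t_lt _.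
rewrite -EFinM -EFinD lee_fin /grid_error.
move: (n.+1%:R^-1) t_lt => e t_lt; lra.
Qed.

Let cvg_EFinP (u : nat -> R) (l : R) :
  u n @[n --> \oo] --> l -> (u n)%:E @[n --> \oo] --> l%:E.
Proof. by move=> ul; apply: cvg_EFin => //; near=> n. Unshelve. all: by end_near. Qed.

Lemma fatou_cost P (B : R) :
  (forall n, \int[P]_x (c (round n x))%:E <= B%:E)%E ->
  (\int[P]_x (c x)%:E <= B%:E)%E.
Proof.
move=> PB.
have -> : (\int[P]_x (c x)%:E =
    \int[P]_x limn_einf (fun n => (c (round n x))%:E))%E.
  apply: eq_integral => x _.
  by have [] := cvg_limn_einf_sup (cvg_EFinP (@cost_round_cvg _ _ _ alphaP x)).
apply: (le_trans (@fatou _ _ _ P setT measurableT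
  (fun n x => (c (round n x))%:E) _ _)).
- by move=> n; apply/measurable_EFinP; exact: measurable_cost_round.
- by move=> n x _; rewrite lee_fin sum_cost_ge0.
rewrite limn_einf_lim; apply: lime_le; first exact: is_cvg_einfs.
by apply: nearW => n; apply: le_trans (PB n); apply: ereal_inf_lbound; exists n => /=.
Qed.

Lemma cost_round_defect_integral_cvg P : (\int[P]_x (c x)%:E < +oo)%E ->
  (\int[P]_x (c ((x : 'rV[R]_d) - round n x))%:E)%E @[n --> \oo] --> 0%E.
Proof.
move=> Pc.
pose D := d%:R * alpha 1.
have D0 : 0 <= D by rewrite mulr_ge0// ql_ge0.
have mc : measurable_fun setT (fun x : X => (c x)%:E).
  by apply/measurable_EFinP; exact: measurable_cost.
have c_int : P.-integrable setT (fun x : X => (c x)%:E).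
  apply/integrableP; split => //.
  by under eq_integral do rewrite gee0_abs ?lee_fin ?sum_cost_ge0//.
have g_int : P.-integrable setT (fun x : X => (2%:E * (c x)%:E + (2 * D)%:E)%E).
  apply: integrableD => //; first exact: integrableZl.
  exact: finite_measure_integrable_cst.
pose f n (x : X) := (c ((x : 'rV[R]_d) - round n x))%:E.
have mf n : measurable_fun setT (f n).
  by apply/measurable_EFinP; exact: measurable_cost_round_defect.
have f_cvg : {ae P, forall x, setT x -> f n x @[n --> \oo] --> 0%E}.
  by apply: aeW => x _; apply: cvg_EFinP; exact: cost_round_defect_cvg.
have f_le : {ae P, forall x n, setT x ->
    (`|f n x| <= 2%:E * (c x)%:E + (2 * D)%:E)%E}.
  apply: aeW => x n _; rewrite gee0_abs ?lee_fin ?sum_cost_ge0//.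
  apply: le_trans (cost_round_defect alphaP n x) _.
  by rewrite lerD2l ler_wpM2l// mesh_cost_le.
have [_ _] := dominated_convergence measurableT mf (measurable_cst 0%E) f_cvg g_int f_le.
by rewrite integral0.
Qed.

End discretised_transport.

(** * The transport inequality of the mixture *)

Section mixture_transport.
Context (R : realType) (d : nat) (alpha : R -> R).
Hypothesis alphaP : quadratic_like alpha.
Local Notation X := (Rd R d).
Local Notation c := (@sum_cost R d alpha).
Local Notation mass n := (@cell_mass _ (Rd R d) R (cells d n) (@cell R d n)).
Context (dT : measure_display) (Theta : measurableType dT)
  (m : probability Theta R) (mu : Theta -> probability (Rd R d) R)
  (mu_measurable : forall A : set (Rd R d), measurable A ->
    measurable_fun [set: Theta] (fun theta => mu theta A)).
Context (C M : R).
Hypotheses (C_gt0 : 0 < C)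
  (mu_transport : forall t (Q : probability X R),
    (transport_cost c (mu t) Q <= C%:E * relative_entropy Q (mu t))%E)
  (mu_chi2 : forall t t', (chi2 (mu t) (mu t') <= M%:E)%E).
Implicit Types (n : nat) (P Q : probability X R).

Let mix : probability X R := mixture m mu_measurable.

Let K : R := 2 * Num.max 1 (2 * M) * (6 / 5 * C).

Let C_ge0 : 0 <= C := ltW C_gt0.

Let K_gt0 : 0 < K.
Proof. by rewrite !mulr_gt0// ?divr_gt0// lt_max ltr01. Qed.

Let K_ge0 : 0 <= K := ltW K_gt0.

(** Four of the five error terms come from the two steps of
    [finite_mixture_transport]; the fifth pays for the approximation of the
    infinite mixture. *)
Lemma mixture_transport_on_grid n (q : cells d n -> R) :
  prob_vec q -> abs_cont q (mass n mix) ->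
  transportable (@grid_cost R d alpha n) (mass n mix) q
    (K * vec_entropy q (mass n mix) + 5 * grid_error d alpha n).
Proof.
move=> q_prob q_ac; have mT := @measurable_cell R d n.
pose p t := mass n (mu t).
have p_prob t : prob_vec (p t) by exact: prob_vec_cell_mass.
have p_meas k : measurable_fun setT (fun t => p t k).
  apply/measurable_EFinP; rewrite (_ : EFin \o _ = fun t => mu t (cell n @^-1` [set k])).
    by apply: mu_measurable; exact: mT.
  by apply/funext => t; apply/esym; exact: cell_massE.
have p_chi t t' : abs_cont (p t) (p t') /\ vec_chi2 (p t) (p t') <= M.
  by apply: cell_chi2_le => //; exact: mu_chi2.
have pbarE k : (\int[m]_t (p t k)%:E = (mass n mix k)%:E)%E.
  rewrite -(cell_massE mT mix).
  by apply: eq_integral => t _; apply/esym; exact: cell_massE.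
have e0 := grid_error_gt0 d alphaP n.
have A0 : 0 <= \sum_k \sum_l @grid_cost R d alpha n k l.
  by do 2 (apply: sumr_ge0 => ? _); exact: sum_cost_ge0.
have C'0 : 0 <= 6 / 5 * C by rewrite mulr_ge0// divr_ge0.
have := infinite_mixture_transport p_prob p_meas
  (fun t t' => proj1 (p_chi t t')) pbarE (@grid_cost_triangle R d alpha alphaP n)
  (@grid_cost_bounded R d alpha alphaP n) A0 C'0 (prob_vec_cell_mass mT mix)
  (fun t t' => proj2 (p_chi t t'))
  (fun t => @transport_inequality_on_grid R d alpha alphaP (mu t) C C_ge0
     (mu_transport t) n) q_prob q_ac e0.
by apply: transportable_le; rewrite -/K; lra.
Qed.

(** The inequality on the grids is applied to the mixture conditioned on cells
    of total mass at least [1 / 2] where the cost is bounded: it can be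
    transported there at a cost that is bounded uniformly in the grid. *)
Lemma mixture_cost_integrable : (\int[mix]_x (c x)%:E < +oo)%E.
Proof.
have mc (r : R) : measurable [set x : X | c x <= r].
  have := @measurable_cost R d alpha alphaP measurableT _ (measurable_itv `]-oo, r]).
  by rewrite setTI; congr measurable; apply/seteqP; split => x /=; rewrite in_itv.
have [r r12] : exists r : R, ((1 / 2)%:E < mix [set x : X | (c x <= r)%R])%E.
  apply: contrapT => h.
  pose F k := [set x : X | c x <= k%:R].
  have : mix (F k) @[k --> \oo] --> mix (\bigcup_k F k).
    apply: nondecreasing_cvg_mu => //; first by move=> k; exact: mc.
      by apply: bigcup_measurable => k _; exact: mc.
    by move=> k l kl; apply/subsetPset => x /=; move=> /le_trans; apply; rewrite ler_nat.
  have -> : \bigcup_k F k = setT.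
    apply/seteqP; split => // x _; exists (Num.truncn (c x)).+1 => //=.
    by apply: ltW; exact: truncnS_gt.
  move=> F_cvg; have : (1%:E <= (1 / 2)%:E :> \bar R)%E.
    rewrite -[X in (X <= _)%E](probability_setT mix) -(cvg_lim _ F_cvg)//.
    apply: lime_le; first by apply/cvg_ex; exists (mix setT).
    by apply: nearW => k; rewrite leNgt; apply/negP => hk; apply: h; exists k%:R.
  by rewrite lee_fin; lra.
pose r1 := 2 * r + 2 * (d%:R * alpha 1).
pose B := 2 * (2 * K + 5 * (6 * (d%:R * alpha 1) + 1)) + 2 * r1.
suff : (\int[mix]_x (c x)%:E <= B%:E)%E by move=> /le_lt_trans; apply; rewrite ltry.
apply: (fatou_cost alphaP) => n.
have mT := @measurable_cell R d n.
pose b (k : cells d n) : R := (c (cell_point R k) <= r1)%R%:R.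
pose Z := \sum_k b k * mass n mix k.
have [p0 p1] := prob_vec_cell_mass mT mix.
have Z12 : 1 / 2 <= Z.
  rewrite -lee_fin -(integral_comp_cellT mT mix b); apply: le_trans (ltW r12) _.
  have <- : (\int[mix]_x (\1_[set x : X | (c x <= r)%R] x)%:E =
      mix [set x : X | (c x <= r)%R])%E.
    by rewrite (integral_indic mix measurableT (mc r)) setIT.
  apply: ge0_le_integral => //.
  - by apply/measurable_EFinP; apply: measurable_indic; exact: (mc r).
  - by apply/measurable_EFinP; exact: measurable_comp_cell.
  - move=> x _; rewrite lee_fin indicE /b; case: (boolP (x \in _)) => //.
    rewrite inE/= => cx; rewrite (_ : (c _ <= _) = true)//.
    apply: le_trans (cost_round alphaP n x) _.
    by rewrite lerD// ler_pM2l// mesh_cost_le.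
have Z0 : 0 < Z by lra.
pose q k := b k * mass n mix k / Z.
have b0 k : 0 <= b k by rewrite ler0n.
have q_prob : prob_vec q.
  split=> [k|]; first by rewrite divr_ge0 ?mulr_ge0// ltW.
  by rewrite -mulr_suml divff// gt_eqF.
have q_ac : abs_cont q (mass n mix) by move=> k k0; rewrite /q k0 mulr0 mul0r.
have [+ _] := grid_moment alphaP (mixture_transport_on_grid q_prob q_ac).
rewrite integral_cost_round lee_fin => /le_trans; apply.
have q_ent : vec_entropy q (mass n mix) <= 2.
  apply: (@le_trans _ _ (\sum_k q k * 2)); last first.
    by rewrite -mulr_suml (proj2 q_prob) mul1r.
  apply: ler_sum => k _.
  have [q_prob0 _] := q_prob; rewrite ler_wpM2l//.
  have [pk|pk] := eqVneq (mass n mix k) 0.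
    by rewrite pk invr0 mulr0 ln0.
  have -> : q k / mass n mix k = b k / Z by rewrite /q; field; rewrite pk gt_eqF.
  rewrite /b; case: (c _ <= _); last by rewrite mul0r ln0.
  apply: le_trans (ln_le_subr1 _) _; first by rewrite divr_gt0.
  rewrite lerBlDr ler_pdivrMr// [leLHS](_ : _ = 1)//; lra.
have q_cost : \sum_k q k * c (cell_point R k) <= r1.
  apply: (@le_trans _ _ (\sum_k q k * r1)); last first.
    by rewrite -mulr_suml (proj2 q_prob) mul1r.
  apply: ler_sum => k _.
  rewrite /q /b; case: (leP (c _) r1) => ck; last by rewrite !mul0r.
  by rewrite ler_wpM2l// divr_ge0 ?mulr_ge0// ltW.
have := ler_wpM2l K_ge0 q_ent; have := grid_error_le d alphaP n.
rewrite /B; lra.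
Qed.

(** A plan between the masses of cells is lifted to a coupling.  Its cost exceeds
    that of the plan, up to the factor [6 / 5], by the cost of rounding under both
    marginals, which tends to zero. *)
Lemma mixture_transport_cost_le Q : Q `<< mix ->
  (transport_cost c mix Q <= (6 / 5 * K)%:E * relative_entropy Q mix)%E.
Proof.
move=> Qmix.
have ent_ge n := cell_entropy_le (@measurable_cell R d n) Qmix.
have q_prob n : prob_vec (mass n Q) := prob_vec_cell_mass (@measurable_cell R d n) Q.
have q_ac n : abs_cont (mass n Q) (mass n mix) :=
  cell_mass_dominates (@measurable_cell R d n) Qmix.
case: (relative_entropy Q mix) ent_ge => [h| |] ent_ge; last first.
- by have := ent_ge 0; rewrite leeNy_eq.
- by rewrite gt0_muley ?leey// lte_fin mulr_gt0 ?divr_gt0.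
have plan_n n := mixture_transport_on_grid (q_prob n) (q_ac n).
have plan_le n : transportable (@grid_cost R d alpha n) (mass n mix) (mass n Q)
    (K * h + 5 * grid_error d alpha n).
  apply: transportable_le (plan_n n); rewrite lerD2r ler_wpM2l//.
  by rewrite -lee_fin; exact: ent_ge.
have mix_c := mixture_cost_integrable.
have Q_c : (\int[Q]_x (c x)%:E < +oo)%E.
  have : (0 <= \int[mix]_x (c x)%:E)%E.
    by apply: integral_ge0 => x _; rewrite lee_fin sum_cost_ge0.
  case tE : (\int[mix]_x (c x)%:E)%E mix_c => [t| |]// _ _.
  pose D := d%:R * alpha 1.
  pose B := 2 * (K * h + 5 * (6 * D + 1)) + 2 * (2 * t + 2 * D).
  suff : (\int[Q]_x (c x)%:E <= B%:E)%E by move=> /le_lt_trans; apply; rewrite ltry.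
  apply: (fatou_cost alphaP) => n; rewrite integral_cost_round lee_fin.
  apply: le_trans (proj2 (grid_moment alphaP (plan_le n))) _.
  rewrite /B lerD//.
    by rewrite ler_pM2l// lerD2l ler_pM2l// grid_error_le.
  rewrite ler_pM2l// -lee_fin -integral_cost_round.
  apply: (@le_trans _ _ (\int[mix]_x (2%:E * (c x)%:E + (2 * D)%:E))%E).
    apply: ge0_le_integral => //.
    - by move=> x _; rewrite lee_fin sum_cost_ge0.
    - by apply/measurable_EFinP; exact: measurable_cost_round.
    - apply: emeasurable_funD => //; apply: measurable_funeM.
      by apply/measurable_EFinP; exact: measurable_cost.
    - move=> x _; apply: le_trans (cost_round alphaP n x) _.
      by rewrite lerD2l ler_pM2l// mesh_cost_le.
  rewrite ge0_integralD//; last 3 first.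
  - by move=> x _; rewrite mule_ge0// lee_fin sum_cost_ge0.
  - by apply: measurable_funeM; apply/measurable_EFinP; exact: measurable_cost.
  - by move=> x _; rewrite lee_fin !mulr_ge0// ql_ge0.
  rewrite ge0_integralZl//; last 2 first.
  - by apply/measurable_EFinP; exact: measurable_cost.
  - by move=> x _; rewrite lee_fin sum_cost_ge0.
  by rewrite integral_cst// [X in (_ + _ * X)%E](probability_setT mix) mule1 tE.
rewrite -EFinM; suff main (e : R) : 0 < e ->
    (transport_cost c mix Q <= (6 / 5 * K * h)%:E + e%:E)%E.
  by apply/lee_addgt0Pr => e e0; exact: main.
move=> e0.
pose f (P : probability X R) n := (\int[P]_x (c ((x : 'rV[R]_d) - round n x))%:E)%E.
have tail P n : (0 <= f P n)%E.
  by apply: integral_ge0 => x _; rewrite lee_fin sum_cost_ge0.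
(* The bounds are chosen so that [6 / 5 * (5 * (e / 12)) + 12 * (2 * (e / 48)) = e]. *)
have f_lt (P : probability X R) : (\int[P]_x (c x)%:E < +oo)%E ->
    \forall n \near \oo, (f P n < (e / 48)%:E)%E.
  move=> /(cost_round_defect_integral_cvg alphaP) f0.
  suff : nbhs (0%E : \bar R) [set y | (y < (e / 48)%:E)%E] by move=> /f0.
  apply: open_nbhs_nbhs; split; first exact: open_ereal_lt_ereal.
  by rewrite /= lte_fin divr_gt0.
near \oo => n.
have f_mix : (f mix n < (e / 48)%:E)%E by near: n; exact: f_lt.
have f_Q : (f Q n < (e / 48)%:E)%E by near: n; exact: f_lt.
have err : grid_error d alpha n < e / 12.
  near: n; apply: (cvgr_lt 0); first exact: grid_error_cvg.
  by rewrite divr_gt0.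
have [w pw cw] := plan_le n.
have mT := @measurable_cell R d n.
have [pi piPQ piw] := plan_lift mT pw.
apply: (@le_trans _ _ (\int[pi]_z (c ((z.1 : 'rV[R]_d) - z.2))%:E)%E).
  by apply: ereal_inf_lbound; exists pi.
have m1 : measurable_fun setT
    (fun z : X * X => (6 / 5 * grid_cost alpha (cell n z.1) (cell n z.2))%:E).
  apply/measurable_EFinP; exact: (measurable_comp_cell (measurable_cell_pair mT)
    (fun kl => 6 / 5 * grid_cost alpha kl.1 kl.2)).
have m_defect : measurable_fun setT (fun x : X => (c ((x : 'rV[R]_d) - round n x))%:E).
  by apply/measurable_EFinP; exact: measurable_cost_round_defect.
have m2 : measurable_fun setT
    (fun z : X * X => (c ((z.1 : 'rV[R]_d) - round n z.1))%:E).
  exact: (measurableT_comp m_defect measurable_fst).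
have m3 : measurable_fun setT
    (fun z : X * X => (c ((z.2 : 'rV[R]_d) - round n z.2))%:E).
  exact: (measurableT_comp m_defect measurable_snd).
have c0 (x : 'rV[R]_d) : (0 <= (c x)%:E)%E by rewrite lee_fin sum_cost_ge0.
have g0 (k l : cells d n) : (0 <= (6 / 5 * grid_cost alpha k l)%:E)%E.
  by rewrite lee_fin mulr_ge0 ?divr_ge0 ?sum_cost_ge0.
have m23 : measurable_fun setT (fun z : X * X =>
    ((c ((z.1 : 'rV[R]_d) - round n z.1))%:E +
     (c ((z.2 : 'rV[R]_d) - round n z.2))%:E)%E) by exact: emeasurable_funD.
apply: (@le_trans _ _ (\int[pi]_z ((6 / 5 * grid_cost alpha (cell n z.1) (cell n z.2))%:E +
    12%:E * ((c ((z.1 : 'rV[R]_d) - round n z.1))%:E +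
             (c ((z.2 : 'rV[R]_d) - round n z.2))%:E)))%E).
  apply: ge0_le_integral => //.
  - by apply/measurable_EFinP; exact: measurable_cost_sub.
  - by apply: emeasurable_funD => //; exact: measurable_funeM.
  - move=> [x y] _; suff : c ((x : 'rV[R]_d) - y) <=
        6 / 5 * grid_cost alpha (cell n x) (cell n y) +
        12 * (c ((x : 'rV[R]_d) - round n x) + c ((y : 'rV[R]_d) - round n y)) by [].
    have -> : x - y = (round n x - round n y) +
        ((x - round n x) + - (y - round n y)) :> 'rV[R]_d.
      by apply/rowP => i; rewrite !mxE; ring.
    apply: le_trans (sum_cost_add_sixth alphaP _ _) _; rewrite lerD2l.
    have := sum_cost_add2 alphaP (x - round n x) (- (y - round n y)).
    by rewrite (sum_cost_opp alphaP); lra.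
rewrite ge0_integralD//; last 2 first.
- by move=> z _; rewrite mule_ge0// adde_ge0.
- exact: measurable_funeM.
rewrite ge0_integralZl//; last by move=> z _; rewrite adde_ge0.
rewrite ge0_integralD//.
rewrite (integral_coupling_fst piPQ (h := fun x => (c ((x : 'rV[R]_d) - round n x))%:E))//.
rewrite (integral_coupling_snd piPQ (h := fun x => (c ((x : 'rV[R]_d) - round n x))%:E))//.
rewrite (integral_cell_plan mT pi (fun k l => 6 / 5 * grid_cost alpha k l)).
have -> : plan_cost (fun k l => 6 / 5 * grid_cost alpha k l) (cell_plan (@cell R d n) pi) =
    6 / 5 * plan_cost (@grid_cost R d alpha n) w.
  rewrite /plan_cost mulr_sumr; apply: eq_bigr => k _.
  by rewrite mulr_sumr; apply: eq_bigr => l _; rewrite piw mulrA.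
rewrite -/(f mix n) -/(f Q n).
move: (tail mix n) f_mix; case: (f mix n) => [u| |]// _; rewrite lte_fin => u_lt.
move: (tail Q n) f_Q; case: (f Q n) => [v| |]// _; rewrite lte_fin => v_lt.
suff : 6 / 5 * plan_cost (@grid_cost R d alpha n) w + 12 * (u + v) <=
    6 / 5 * K * h + e by [].
lra.
Unshelve. all: by end_near. Qed.

End mixture_transport.

(** * The theorem *)

Section divergence_signs.
Context (disp : measure_display) (X : measurableType disp) (R : realType).
Implicit Types P Q : probability X R.
Local Open Scope ereal_scope.

Lemma chi2_ge0 P Q : 0 <= chi2 Q P.
Proof.
rewrite /chi2; case: ifP => [_|_]; last exact: leey.
by apply: integral_ge0 => x _; exact: sqre_ge0.
Qed.

(** Data processing for the partition into a single cell. *)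
Lemma relative_entropy_ge0 P Q : 0 <= relative_entropy Q P.
Proof.
have [QP|nQP] := pselect (Q `<< P); last first.
  by rewrite /relative_entropy asboolF// leey.
pose T (x : X) : unit := tt.
have mT k : measurable (T @^-1` [set k]).
  rewrite (_ : _ @^-1` _ = setT); first exact: measurableT.
  by apply/seteqP; split => // x _ /=; case: k.
apply: le_trans (cell_entropy_le mT QP); rewrite lee_fin.
by apply: vec_entropy_ge0; [exact: prob_vec_cell_mass..|exact: cell_mass_dominates].
Qed.

End divergence_signs.

Theorem theorem2p3 (R : realType) (d : nat)
  (alpha : R -> R)
  (alpha_ge0 : forall t, 0 <= alpha t)
  (alpha_sym : forall t, alpha (- t) = alpha t)
  (alpha_convex : convex_function [set: R^o] alpha)
  (alpha_derivable : forall t, derivable alpha t 1)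
  (alpha_C1 : continuous (alpha^`()%classic : R -> R))
  (t0 : R) (t0_gt0 : 0 < t0)
  (alpha_quadratic : forall t, 0 <= t <= t0 -> alpha t = 2^-1 * t ^+ 2)
  (alpha'_concave :
    convex_function (`[0, +oo[%classic : set R^o) (fun t => - alpha^`()%classic t))
  (dT : measure_display) (Theta : measurableType dT) (m : probability Theta R)
  (mu : Theta -> probability (Rd R d) R)
  (mu_measurable : forall A : set (Rd R d), measurable A ->
    measurable_fun [set: Theta] (fun theta => mu theta A)) :
  let c : 'rV[R]_d -> R := sum_cost alpha in
  let C_Theta : \bar R :=
    ereal_sup [set T_constant c (mu theta) | theta in [set: Theta]] in
  let M_Theta : \bar R :=
    ereal_sup [set chi2 (mu p.1) (mu p.2) | p in [set: Theta * Theta]] in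
  (C_Theta < +oo)%E ->
  (M_Theta < +oo)%E ->
  satisfies_T c (mixture m mu_measurable) /\
  (T_constant c (mixture m mu_measurable) <=
   C_Theta *
     (16%:E + 2%:E * (2%:E + M_Theta) * lne (1%:E + M_Theta)))%E.
Proof.
move=> c C_Theta M_Theta C_lty M_lty.
have alpha0 : alpha 0 = 0.
  by rewrite alpha_quadratic ?lexx ?ltW// expr0n mulr0.
have alphaP : quadratic_like alpha by exact: quadratic_like_cost.
have [theta _] := probability_inhabited m.
have M_ub t t' : (chi2 (mu t) (mu t') <= M_Theta)%E.
  by apply: ereal_sup_ubound; exists (t, t').
have M_ge0 : (0 <= M_Theta)%E := le_trans (chi2_ge0 _ _) (M_ub theta theta).
have C_ub t : (T_constant c (mu t) <= C_Theta)%E.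
  by apply: ereal_sup_ubound; exists t.
have C_ge0 : (0 <= C_Theta)%E.
  apply: le_trans (C_ub theta); apply: le_ereal_inf_tmp => _ [C [C0 _] <-].
  by rewrite lee_fin ltW.
clearbody M_Theta C_Theta.
case: M_Theta M_lty M_ge0 M_ub => [M| |]// _; rewrite lee_fin => M_ge0 M_ub.
case: C_Theta C_lty C_ge0 C_ub => [C0| |]// _; rewrite lee_fin => C0_ge0 C_ub.
pose K : R := 16 + 2 * (2 + M) * ln (1 + M).
have K_gt0 : 0 < K.
  by rewrite ltr_wpDr// !mulr_ge0 ?addr_ge0// ln_ge0// lerDl.
have -> : (C0%:E * (16%:E + 2%:E * (2%:E + M%:E) * lne (1%:E + M%:E)) =
    (C0 * K)%:E)%E.
  by rewrite -EFinD lne_EFin// ltr_wpDr.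
have mixT (C : R) : C0 < C -> satisfies_T_with c (mixture m mu_measurable) (C * K).
  move=> C0C; have C_gt0 : 0 < C := le_lt_trans C0_ge0 C0C.
  split; first exact: mulr_gt0.
  move=> Q; have [Qmix|nQmix] := pselect (Q `<< mixture m mu_measurable); last first.
    rewrite /relative_entropy asboolF//.
    by rewrite gt0_muley ?leey// lte_fin mulr_gt0.
  have muT t (P : probability (Rd R d) R) :
      (transport_cost c (mu t) P <= C%:E * relative_entropy P (mu t))%E.
    have /ereal_inf_lt[_ [C' [C'_gt0 C'T] <-] C'C] : (T_constant c (mu t) < C%:E)%E.
      by apply: le_lt_trans (C_ub t) _; rewrite lte_fin.
    apply: le_trans (C'T P) _; apply: lee_wpmul2r; last exact: ltW.
    exact: relative_entropy_ge0.
  have := mixture_transport_cost_le alphaP C_gt0 muT M_ub Qmix.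
  move=> /le_trans; apply; apply: lee_wpmul2r.
    exact: relative_entropy_ge0.
  rewrite lee_fin; have := ler_wpM2l (ltW C_gt0) (mixture_constant_ge M_ge0).
  by rewrite -/K; lra.
split.
  by exists ((C0 + 1) * K); apply: mixT; rewrite ltrDl.
apply/lee_addgt0Pr => e e0.
have := mixT (C0 + e / K); rewrite ltrDl divr_gt0// => /(_ isT) h.
have -> : ((C0 * K)%:E + e%:E = ((C0 + e / K) * K)%:E)%E.
  by rewrite -EFinD mulrDl divfK// gt_eqF.
by apply: ereal_inf_lbound; exists ((C0 + e / K) * K).
Qed.
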